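(* Let $E_{n*}$ be the complete coefficient ring of a Lubin-Tate formal group law at the prime $2$, with formal group law $x+_Fy=\sum a_{ij}x^iy^j$ and $[2]x=\sum_j c_jx^j$ over $E_{n*}$. The Borel cohomology $\mathbb{Z}/2$-equivariant Lubin-Tate formal group law on $E_{n*}[[u]]/([2]u)$ can be deformed to a $\mathbb{Z}/2$-equivariant formal group law over $$E_{n*}[[u]][w]/\bigl(([2]u)(1-uw)\bigr),$$ namely the one classified by the ring homomorphism from $MU_*^{\mathbb{Z}/2}$ extending the classifying map $MU_*\to E_{n*}$ of the Lubin-Tate law, with $u\mapsto u$ and $$b_{ij}\mapsto\sum_{k\ge j}a_{ik}u^{k-j},\qquad q_j\mapsto\sum_{k\ge j}c_ku^{k-j}-w^j[2]u .$$ The spectrum of the ring $E_{n*}[[u]][w]/\bigl(([2]u)(1-uw)\bigr)$ is (Zariski-)connected.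
   Context: $E_{n*}=W(\kappa)[[u_1,\dots,u_{n-1}]][t,t^{-1}]$, with $\kappa$ a perfect field of characteristic $2$ (the periodicity element $t$ may be neglected from the notation), carrying the universal deformation of a height $n$ formal group law over $\kappa$; $[2]u$ is the $2$-series evaluated at $u$. $MU_*$ is the Lazard ring; write its universal formal group law as $\sum a_{ij}x^iy^j$ and its $2$-series as $\sum_j c_jx^j$ (the same letters denote the images in $E_{n*}$). The coefficient ring of $\mathbb{Z}/2$-equivariant stable complex cobordism is $$MU^{\mathbb{Z}/2}_*=MU_*[u,q_j,b_{ij}\mid i\ge1,j\ge0]/(q_0,\;q_i-c_i-uq_{i+1},\;b_{ij}-a_{ij}-ub_{i,j+1}),$$ and it represents $\mathbb{Z}/2$-equivariant formal group laws: ring homomorphisms $MU^{\mathbb{Z}/2}_*\to A$ (ignoring gradings) correspond to $\mathbb{Z}/2$-equivariant formal group laws over $A$, with $u$ the Euler class. The Borel cohomology equivariant formal group law over $E_{n*}[[u]]/([2]u)$ is the one classified by $u\mapsto u$, $b_{ij}\mapsto\sum_{k\ge j}a_{ik}u^{k-j}$, $q_j\mapsto\sum_{k\ge j}c_ku^{k-j}$. ''Deformed'' means that the new equivariant formal group law reduces to the Borel one upon setting $w=0$. *)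

(* Defs.v *)
From HB Require Import structures.
From mathcomp Require Import all_boot all_order all_algebra.
From mathcomp Require Import finmap.
From mathcomp Require Import -(notations) monalg.
From mathcomp Require Import mpoly.
From mathcomp Require Import all_classical.
From mathcomp Require Import topology.

Set Implicit Arguments.
Unset Strict Implicit.
Unset Printing Implicit Defensive.

Import GRing.Theory.
Local Open Scope ring_scope.
Local Open Scope classical_set_scope.

Record fps (n : nat) (R : Type) := Fps { fps_coef :> 'X_{1..n} -> R }.

Notation "{ 'fps' R [ n ] }" := (fps n R)
  (at level 0, R, n at level 2, format "{ 'fps'  R [ n ] }") : type_scope.

HB.instance Definition _ n R := gen_eqMixin {fps R[n]}.
HB.instance Definition _ n R := gen_choiceMixin {fps R[n]}.

Lemma fpsP n R (f g : {fps R[n]}) : (forall m, f m = g m) -> f = g.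
Proof. by case: f g => f [g] /= /funext ->. Qed.

Section FpsRing.
Variables (n : nat) (R : comNzRingType).
Implicit Types f g h : {fps R[n]}.

Definition fps_zero : {fps R[n]} := Fps (fun=> 0).
Definition fps_opp f : {fps R[n]} := Fps (fun m => - f m).
Definition fps_add f g : {fps R[n]} := Fps (fun m => f m + g m).
Definition fps_one : {fps R[n]} := Fps (fun m => (m == 0%MM)%:R).
Definition fps_mul f g : {fps R[n]} := Fps (fun m =>
  \sum_(k : 'X_{1..n < (mdeg m).+1, (mdeg m).+1} | m == (k.1 + k.2)%MM)
    f k.1 * g k.2).

Let trunc d f : {mpoly R[n]} := \sum_(k : 'X_{1..n < d}) f k *: 'X_[k].

Let coef_trunc d f m : (mdeg m < d)%N -> (trunc d f)@_m = f m.
Proof. exact: mcoeff_mpoly. Qed.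

Let coefM_trunc d (p q : {mpoly R[n]}) f g m : (mdeg m < d)%N ->
  (forall k, (mdeg k < d)%N -> p@_k = f k) ->
  (forall k, (mdeg k < d)%N -> q@_k = g k) ->
  (p * q)@_m = fps_mul f g m.
Proof.
move=> md pf qg; rewrite mcoeffM; apply: eq_bigr => -[[k1 k1m] [k2 k2m]] /= _.
by rewrite pf ?qg // (leq_trans _ md).
Qed.

Fact fps_addA : associative fps_add.
Proof. by move=> f g h; apply: fpsP => m /=; rewrite addrA. Qed.
Fact fps_addC : commutative fps_add.
Proof. by move=> f g; apply: fpsP => m /=; rewrite addrC. Qed.
Fact fps_add0 : left_id fps_zero fps_add.
Proof. by move=> f; apply: fpsP => m /=; rewrite add0r. Qed.
Fact fps_addN : left_inverse fps_zero fps_opp fps_add.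
Proof. by move=> f; apply: fpsP => m /=; rewrite addNr. Qed.

HB.instance Definition _ := GRing.isZmodule.Build {fps R[n]}
  fps_addA fps_addC fps_add0 fps_addN.

Fact fps_mulA : associative fps_mul.
Proof.
move=> f g h; apply: fpsP => m; set d := (mdeg m).+1.
have trE (p : {fps R[n]}) k : (mdeg k < d)%N -> (trunc d p)@_k = p k.
  exact: coef_trunc.
have trM (p q : {fps R[n]}) k :
    (mdeg k < d)%N -> (trunc d p * trunc d q)@_k = fps_mul p q k.
  by move=> kd; apply: coefM_trunc kd _ _ => l; apply: trE.
have md : (mdeg m < d)%N by [].
rewrite -(coefM_trunc md (trE f) (trM g h)).
by rewrite -(coefM_trunc md (trM f g) (trE h)) mulrA.
Qed.
Fact fps_mulC : commutative fps_mul.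
Proof.
move=> f g; apply: fpsP => m; set d := (mdeg m).+1.
rewrite -(@coefM_trunc d (trunc d f) (trunc d g)) //; try exact: coef_trunc.
rewrite -(@coefM_trunc d (trunc d g) (trunc d f)) //; try exact: coef_trunc.
by rewrite mulrC.
Qed.
Fact fps_mul1 : left_id fps_one fps_mul.
Proof.
move=> f; apply: fpsP => m; set d := (mdeg m).+1.
rewrite -(@coefM_trunc d 1 (trunc d f)) //; try exact: coef_trunc.
  by rewrite mul1r coef_trunc.
by move=> k _; rewrite mcoeff1.
Qed.
Fact fps_mulDl : left_distributive fps_mul fps_add.
Proof.
move=> f g h; apply: fpsP => m /=; rewrite -big_split /=.
by apply: eq_bigr => k _; rewrite mulrDl.
Qed.
Fact fps_one_neq0 : fps_one != 0.
Proof.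
apply/eqP => /(congr1 (fun f : {fps R[n]} => f 0%MM)) /=.
by rewrite eqxx => /eqP; rewrite oner_eq0.
Qed.

HB.instance Definition _ := GRing.Zmodule_isComNzRing.Build {fps R[n]}
  fps_mulA fps_mulC fps_mul1 fps_mulDl fps_one_neq0.

Definition fpsX (i : 'I_n) : {fps R[n]} := Fps (fun m => (m == U_(i)%MM)%:R).

Definition fps_const f : R := f 0%MM.

Fact fps_const_zmod : zmod_morphism fps_const.
Proof. by []. Qed.
HB.instance Definition _ :=
  GRing.isZmodMorphism.Build {fps R[n]} R fps_const fps_const_zmod.
Fact fps_const_monoid : monoid_morphism fps_const.
Proof.
split=> [|f g]; first by rewrite /fps_const /= eqxx.
change (fps_mul f g 0%MM = f 0%MM * g 0%MM).
rewrite -(@coefM_trunc 1 (trunc 1 f) (trunc 1 g)) ?mdeg0 //;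
  try exact: coef_trunc.
rewrite [LHS](rmorphM (@mpoly.mcoeff n R 0%MM)) /=.
by rewrite !coef_trunc ?mdeg0.
Qed.
HB.instance Definition _ :=
  GRing.isMonoidMorphism.Build {fps R[n]} R fps_const fps_const_monoid.

End FpsRing.

Section FpsMap.
Variables (n : nat) (R S : comNzRingType) (phi : {rmorphism R -> S}).

Definition fps_map (f : {fps R[n]}) : {fps S[n]} := Fps (fun m => phi (f m)).

Fact fps_map_zmod : zmod_morphism fps_map.
Proof. by move=> f g; apply: fpsP => m /=; rewrite rmorphB. Qed.
HB.instance Definition _ :=
  GRing.isZmodMorphism.Build {fps R[n]} {fps S[n]} fps_map fps_map_zmod.
Fact fps_map_monoid : monoid_morphism fps_map.
Proof.
split=> [|f g]; apply: fpsP => m /=; first by rewrite rmorph_nat.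
by rewrite rmorph_sum; apply: eq_bigr => k _; rewrite rmorphM.
Qed.
HB.instance Definition _ :=
  GRing.isMonoidMorphism.Build {fps R[n]} {fps S[n]} fps_map fps_map_monoid.

Lemma fps_map0 : fps_map 0 = 0. Proof. exact: rmorph0. Qed.

Lemma fps_mapB f g : fps_map (f - g) = fps_map f - fps_map g.
Proof. exact: rmorphB. Qed.

Lemma fps_mapX i : fps_map (fpsX R i) = fpsX S i.
Proof. by apply: fpsP => m /=; rewrite rmorph_nat. Qed.

End FpsMap.

(* f(g_0, ..., g_(k-1)); meaningful when every g_i has zero constant term, so
   that only the monomials of f of degree at most |m| contribute to the
   coefficient of the monomial m. *)
Definition fps_comp (R : comNzRingType) (k n : nat)
    (f : {fps R[k]}) (g : 'I_k -> {fps R[n]}) : {fps R[n]} := Fps (fun m =>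
  \sum_(h : 'X_{1..k < (mdeg m).+1}) f h * (\prod_(i < k) g i ^+ bmnm h i) m).

Definition fps_comp2 (R : comNzRingType) (n : nat)
    (F : {fps R[2]}) (f g : {fps R[n]}) : {fps R[n]} :=
  fps_comp F (fun i => if i == ord0 then f else g).

Lemma fps_map_comp (R S : comNzRingType) (phi : {rmorphism R -> S}) k n
    (f : {fps R[k]}) (g : 'I_k -> {fps R[n]}) :
  fps_map phi (fps_comp f g) = fps_comp (fps_map phi f) (fps_map phi \o g).
Proof.
apply: fpsP => m /=; rewrite rmorph_sum; apply: eq_bigr => h _.
rewrite rmorphM; congr (_ * _).
rewrite -[LHS]/(fps_map phi _ m) rmorph_prod.
by congr (fps_coef _ m); apply: eq_bigr => i _; rewrite rmorphXn.
Qed.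

Lemma fps_map_comp2 (R S : comNzRingType) (phi : {rmorphism R -> S}) n
    (F : {fps R[2]}) (f g : {fps R[n]}) :
  fps_map phi (fps_comp2 F f g)
  = fps_comp2 (fps_map phi F) (fps_map phi f) (fps_map phi g).
Proof.
rewrite /fps_comp2 fps_map_comp; congr fps_comp.
by apply/funext => i /=; case: ifP.
Qed.

Definition fgl_axiom (R : comNzRingType) (F : {fps R[2]}) : Prop :=
  [/\ fps_comp2 F (fpsX R (ord0 : 'I_1)) 0 = fpsX R ord0,
      fps_comp2 F 0 (fpsX R (ord0 : 'I_1)) = fpsX R ord0,
      fps_comp2 F (fpsX R (inord 1)) (fpsX R (inord 0)) = F
    & let x := fpsX R (inord 0 : 'I_3) in
      let y := fpsX R (inord 1) in
      let z := fpsX R (inord 2) in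
      fps_comp2 F (fps_comp2 F x y) z = fps_comp2 F x (fps_comp2 F y z)].

Record fgl (R : comNzRingType) := Fgl {
  fgl_series :> {fps R[2]};
  fgl_seriesP : fgl_axiom fgl_series }.

(* a_ij *)
Definition fgl_coef (R : comNzRingType) (F : {fps R[2]}) (i j : nat) : R :=
  F [multinom [tuple i; j]].

(* [2](x) = F(x, x) and its coefficients c_j *)
Definition two_series (R : comNzRingType) (F : {fps R[2]}) : {fps R[1]} :=
  fps_comp2 F (fpsX R ord0) (fpsX R ord0).

Definition two_coef (R : comNzRingType) (F : {fps R[2]}) (j : nat) : R :=
  two_series F [multinom [tuple j]].

Section FglMap.
Variables (R S : comNzRingType) (phi : {rmorphism R -> S}).

Fact fgl_map_axiom (F : fgl R) : fgl_axiom (fps_map phi F).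
Proof.
case: F => F [/= F0 F0' FC FA]; split.
- by rewrite -[in RHS](fps_mapX phi) -F0 fps_map_comp2 fps_mapX fps_map0.
- by rewrite -[in RHS](fps_mapX phi) -F0' fps_map_comp2 fps_mapX fps_map0.
- by rewrite -[in RHS]FC fps_map_comp2 !fps_mapX.
- by have /= := congr1 (fps_map phi) FA; rewrite !fps_map_comp2 !fps_mapX.
Qed.

Definition fgl_map (F : fgl R) : fgl S := Fgl (fgl_map_axiom F).

Lemma fps_map_two_series (F : {fps R[2]}) :
  fps_map phi (two_series F) = two_series (fps_map phi F).
Proof. by rewrite /two_series fps_map_comp2 !fps_mapX. Qed.

End FglMap.

Lemma fps_compD (R : comNzRingType) k n (f f' : {fps R[k]})
    (g : 'I_k -> {fps R[n]}) :
  fps_comp (f + f') g = fps_comp f g + fps_comp f' g.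
Proof.
apply: fpsP => m /=; rewrite -big_split /=.
by apply: eq_bigr => h _; rewrite mulrDl.
Qed.

Lemma fps_compX (R : comNzRingType) k n i (g : 'I_k -> {fps R[n]}) :
  fps_const (g i) = 0 -> fps_comp (fpsX R i) g = g i.
Proof.
move=> gi0; apply: fpsP => m /=.
have [m0|m_gt0] := posnP (mdeg m).
  have -> : m = 0%MM by apply/eqP; rewrite -mdeg_eq0 m0.
  rewrite -[RHS]/(fps_const (g i)) gi0 big1 // => h _.
  have [hE|_] := eqVneq (bmnm h) U_(i)%MM; last by rewrite mul0r.
  by have := bmdeg h; rewrite hE mdeg1 mdeg0.
have iP : (mdeg U_(i)%MM < (mdeg m).+1)%N by rewrite mdeg1.
rewrite (bigD1 (BMultinom iP)) //= eqxx mul1r [X in _ + X]big1 ?addr0; last first.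
  move=> h hne; have [hE|_] := eqVneq (bmnm h) U_(i)%MM; last by rewrite mul0r.
  by case/eqP: hne; apply/eqP; rewrite bmeqP /= hE.
congr (fps_coef _ m); rewrite (bigD1 i) //= mnm1E eqxx expr1 big1 ?mulr1 //.
by move=> j ji; rewrite mnm1E eq_sym (negPf ji) expr0.
Qed.

Section AdditiveLaw.
Variable R : comNzRingType.

Definition fgl_add_series : {fps R[2]} := fpsX R (inord 0) + fpsX R (inord 1).

Let fps_const0 n : fps_const (0 : {fps R[n]}) = 0. Proof. by []. Qed.

Let fps_constX n (i : 'I_n) : fps_const (fpsX R i) = 0.
Proof. by rewrite /fps_const /= eq_sym mnm1_eq0. Qed.

Let addE n (f g : {fps R[n]}) : fps_const f = 0 -> fps_const g = 0 ->
  fps_comp2 fgl_add_series f g = f + g.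
Proof.
move=> f0 g0; rewrite /fps_comp2 fps_compD !fps_compX //=.
- by rewrite -!val_eqE /= !inordK.
- by case: ifP.
- by case: ifP.
Qed.

Fact fgl_add_axiom : fgl_axiom fgl_add_series.
Proof.
have fps_constXD n (i j : 'I_n) : fps_const (fpsX R i + fpsX R j) = 0.
  have -> : fps_const (fpsX R i + fpsX R j)
          = fps_const (fpsX R i) + fps_const (fpsX R j) by [].
  by rewrite !fps_constX addr0.
split; rewrite /= ?addE // ?(addr0, add0r) ?addrA //.
exact: addrC.
Qed.

Definition fgl_add : fgl R := Fgl fgl_add_axiom.

End AdditiveLaw.

Definition ideal_gen (R : comNzRingType) (S : set R) : set R := [set x |
  exists s : seq (R * R),
    (forall p, p \in s -> S p.2) /\ x = \sum_(p <- s) p.1 * p.2].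

Section GenQuotient.
Variables (R : comNzRingType) (S : set R).

Lemma ideal_gen_sub x : S x -> ideal_gen S x.
Proof.
move=> Sx; exists [:: (1, x)]; split; last by rewrite big_seq1 mul1r.
by move=> p; rewrite inE => /eqP ->.
Qed.

Lemma ideal_gen_proper (T : comNzRingType) (f : {rmorphism R -> T}) :
  (forall x, S x -> f x = 0) -> ~ ideal_gen S 1.
Proof.
move=> fS [s [sS s1]]; have /eqP := congr1 f s1; apply/negP.
rewrite rmorph1 rmorph_sum big_seq big1 ?oner_eq0 // => p ps.
by rewrite rmorphM (fS p.2) ?mulr0 //; apply: sS.
Qed.

Definition ideal_pred of ~ ideal_gen S 1 : R -> bool :=
  fun x => `[< ideal_gen S x >].

Fact ideal_pred_closed h : idealr_closed (@ideal_pred h).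
Proof.
split=> [||a x y].
- by apply/asboolP; exists [::]; rewrite big_nil.
- by apply/asboolP.
move=> /asboolP[s [sS ->]] /asboolP[t [tS ->]]; apply/asboolP.
exists ([seq (a * p.1, p.2) | p <- s] ++ t); split=> [p|].
  by rewrite mem_cat => /orP[/mapP[q qs ->]|/tS //]; exact: (sS q qs).
rewrite big_cat big_map mulr_sumr /=; congr (_ + _).
by apply: eq_bigr => p _; rewrite mulrA.
Qed.
HB.instance Definition _ h :=
  isIdealr.Build R (@ideal_pred h) (ideal_pred_closed h).

Definition gideal h : idealr R := @ideal_pred h.

Local Open Scope quotient_scope.

Definition gquot (h : ~ ideal_gen S 1) : Type := {ideal_quot (gideal h)}.
HB.instance Definition _ h := GRing.ComNzRing.on (gquot h).

Variable h : ~ ideal_gen S 1.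

Definition gquot_pi : R -> gquot h := \pi_{ideal_quot (gideal h)}.

Fact gquot_pi_zmod : zmod_morphism gquot_pi.
Proof. exact: (rmorphB \pi_{ideal_quot (gideal h)}). Qed.
Fact gquot_pi_monoid : monoid_morphism gquot_pi.
Proof.
split; first exact: (rmorph1 \pi_{ideal_quot (gideal h)}).
exact: (rmorphM \pi_{ideal_quot (gideal h)}).
Qed.
HB.instance Definition _ :=
  GRing.isZmodMorphism.Build R (gquot h) gquot_pi gquot_pi_zmod.
HB.instance Definition _ :=
  GRing.isMonoidMorphism.Build R (gquot h) gquot_pi gquot_pi_monoid.

Lemma gquot_piP x y : gquot_pi x = gquot_pi y <-> ideal_gen S (x - y).
Proof.
rewrite /gquot_pi; split=> [/eqP|xy]; first by rewrite -Quotient.idealrBE => /asboolP.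
by apply/eqP; rewrite -Quotient.idealrBE; apply/asboolP.
Qed.

Lemma gquot_pi_surj (x : gquot h) : exists y, gquot_pi y = x.
Proof. by exists (repr x); rewrite /gquot_pi reprK. Qed.

Section Lift.
Variables (T : comNzRingType) (f : {rmorphism R -> T}).
Hypothesis fS : forall x, S x -> f x = 0.

Definition gquot_lift of (forall x, S x -> f x = 0) : gquot h -> T :=
  fun x => f (repr x).

Lemma gquot_lift_pi x : gquot_lift fS (gquot_pi x) = f x.
Proof.
apply/eqP; rewrite -subr_eq0 -rmorphB; apply/eqP.
have /gquot_piP[s [sS ->]] :
    gquot_pi (repr (gquot_pi x)) = gquot_pi x by rewrite /gquot_pi reprK.
rewrite rmorph_sum big_seq big1 // => p ps.
by rewrite rmorphM (fS (sS _ ps)) mulr0.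
Qed.

Fact gquot_lift_zmod : zmod_morphism (gquot_lift fS).
Proof.
move=> x y; have [[x' <-] [y' <-]] := (gquot_pi_surj x, gquot_pi_surj y).
by rewrite -rmorphB !gquot_lift_pi rmorphB.
Qed.
Fact gquot_lift_monoid : monoid_morphism (gquot_lift fS).
Proof.
split=> [|x y]; first by rewrite -(rmorph1 gquot_pi) gquot_lift_pi rmorph1.
have [[x' <-] [y' <-]] := (gquot_pi_surj x, gquot_pi_surj y).
by rewrite -rmorphM !gquot_lift_pi rmorphM.
Qed.

End Lift.

HB.instance Definition _ (T : comNzRingType) (f : {rmorphism R -> T})
    (fS : forall x, S x -> f x = 0) := GRing.isZmodMorphism.Build (gquot h) T
  (gquot_lift fS) (@gquot_lift_zmod T f fS).
HB.instance Definition _ (T : comNzRingType) (f : {rmorphism R -> T})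
    (fS : forall x, S x -> f x = 0) := GRing.isMonoidMorphism.Build (gquot h) T
  (gquot_lift fS) (@gquot_lift_monoid T f fS).

End GenQuotient.

(* R[x_i | i : I] for a possibly infinite family of variables *)
Definition polyring (I : choiceType) (R : comNzRingType) : Type :=
  malg (cmonom I) R.
HB.instance Definition _ I R := GRing.ComNzRing.on (polyring I R).

Section PolyRing.
Variables (I : choiceType) (R : comNzRingType).

Definition pvar (i : I) : polyring I R := mkmalgU (ucm i) 1.
Definition pconst : R -> polyring I R := fun c => mkmalgU (mone : cmonom I) c.

Fact pconst_zmod : zmod_morphism pconst.
Proof. exact: (rmorphB (mkmalgU (mone : cmonom I))). Qed.
Fact pconst_monoid : monoid_morphism pconst.
Proof.
split; first exact: (rmorph1 (mkmalgU (mone : cmonom I))).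
exact: (rmorphM (mkmalgU (mone : cmonom I))).
Qed.
HB.instance Definition _ :=
  GRing.isZmodMorphism.Build R (polyring I R) pconst pconst_zmod.
HB.instance Definition _ :=
  GRing.isMonoidMorphism.Build R (polyring I R) pconst pconst_monoid.

Section Eval.
Variables (T : comNzRingType) (f : {rmorphism R -> T}) (v : I -> T).

Definition pmonom_val (m : cmonom I) : T :=
  \prod_(i <- finsupp m) v i ^+ m i.

Let pmonom_valEw (d : {fset I}) (m : cmonom I) : (finsupp m `<=` d)%fset ->
  pmonom_val m = \prod_(i <- d) v i ^+ m i.
Proof.
move=> le_d; rewrite /pmonom_val (big_fset_incl _ le_d) // => i _.
by rewrite -cmE_neq0 negbK => /eqP ->.
Qed.

Fact pmonom_val_morph : mmorphism pmonom_val.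
Proof.
split=> [m1 m2|]; last by rewrite /pmonom_val mdom1 big_seq_fset0.
rewrite (pmonom_valEw (m := m1) (fsubsetUl _ (finsupp m2))).
rewrite (pmonom_valEw (m := m2) (fsubsetUr (finsupp m1) _)).
rewrite /pmonom_val mdomD -big_split /=.
by apply: eq_bigr => i _; rewrite cmM exprD.
Qed.
HB.instance Definition _ :=
  isMultiplicative.Build (cmonom I) T pmonom_val pmonom_val_morph.

Definition peval : polyring I R -> T := monalg.mmap f pmonom_val.

Fact peval_zmod : zmod_morphism peval.
Proof. exact: (rmorphB (monalg.mmap f pmonom_val)). Qed.
Fact peval_monoid : monoid_morphism peval.
Proof.
split; first exact: (rmorph1 (monalg.mmap f pmonom_val)).
exact: (rmorphM (monalg.mmap f pmonom_val)).
Qed.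
HB.instance Definition _ :=
  GRing.isZmodMorphism.Build (polyring I R) T peval peval_zmod.
HB.instance Definition _ :=
  GRing.isMonoidMorphism.Build (polyring I R) T peval peval_monoid.

Lemma peval_var i : peval (pvar i) = v i.
Proof.
have -> : peval (pvar i) = f 1 * pmonom_val (ucm i) by apply: monalg.mmapU.
by rewrite rmorph1 mul1r /pmonom_val mdomU big_seq_fset1 cmUU expr1.
Qed.

Lemma peval_const c : peval (pconst c) = f c.
Proof.
have -> : peval (pconst c) = f c * pmonom_val mone by apply: monalg.mmapU.
by rewrite mmorph1 mulr1.
Qed.

End Eval.
End PolyRing.

(* The coefficientwise form of [fgl_axiom]. *)
Inductive fgl_rel (R : comNzRingType) (F : {fps R[2]}) : R -> Prop :=
| FglRelUnitR m : fgl_rel F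
    ((fps_comp2 F (fpsX R (ord0 : 'I_1)) 0 - fpsX R ord0 : {fps R[1]}) m)
| FglRelUnitL m : fgl_rel F
    ((fps_comp2 F 0 (fpsX R (ord0 : 'I_1)) - fpsX R ord0 : {fps R[1]}) m)
| FglRelComm m : fgl_rel F
    ((fps_comp2 F (fpsX R (inord 1)) (fpsX R (inord 0)) - F : {fps R[2]}) m)
| FglRelAssoc m : fgl_rel F
    (let x := fpsX R (inord 0 : 'I_3) in
     let y := fpsX R (inord 1) in
     let z := fpsX R (inord 2) in
     (fps_comp2 F (fps_comp2 F x y) z
      - fps_comp2 F x (fps_comp2 F y z) : {fps R[3]}) m).

Lemma fgl_relP (R : comNzRingType) (F : {fps R[2]}) :
  fgl_axiom F <-> (forall r, fgl_rel F r -> r = 0).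
Proof.
split=> [[F0 F0' FC FA] r [] m|rel0].
- by rewrite F0 subrr.
- by rewrite F0' subrr.
- by rewrite FC subrr.
- by move: FA; cbv zeta => ->; rewrite subrr.
have E n (f g : {fps R[n]}) : (forall m, (f - g) m = 0) -> f = g.
  by move=> fg; apply/eqP; rewrite -subr_eq0; apply/eqP/fpsP.
split; apply: E => m; apply: rel0; first exact: FglRelUnitR.
- exact: FglRelUnitL.
- exact: FglRelComm.
- exact: FglRelAssoc.
Qed.

Lemma fgl_rel_map (R S : comNzRingType) (phi : {rmorphism R -> S})
    (F : {fps R[2]}) r :
  fgl_rel F r -> fgl_rel (fps_map phi F) (phi r).
Proof.
have E n (f : {fps R[n]}) m : phi (f m) = fps_map phi f m by [].
case=> m; cbv zeta; rewrite E fps_mapB !fps_map_comp2 !fps_mapX ?fps_map0.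
- exact: FglRelUnitR.
- exact: FglRelUnitL.
- exact: FglRelComm.
- exact: FglRelAssoc.
Qed.

Definition lazard_pre : Type := polyring (nat * nat)%type int.
HB.instance Definition _ := GRing.ComNzRing.on lazard_pre.

Definition lazard_pre_series : {fps lazard_pre[2]} :=
  Fps (fun m => pvar int (m ord0, m ord_max)).

Definition lazard_pre_eval (R : comNzRingType) (F : {fps R[2]}) :
    {rmorphism lazard_pre -> R} :=
  peval intr (fun ij => fgl_coef F ij.1 ij.2).

Lemma lazard_pre_evalE (R : comNzRingType) (F : {fps R[2]}) :
  fps_map (lazard_pre_eval F) lazard_pre_series = F.
Proof.
apply: fpsP => m; rewrite /= peval_var /fgl_coef; congr (fps_coef F _).
apply/mnmP => i; rewrite multinomE (tnth_nth 0%N) /=.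
by case: i => -[|[|//]] ip; congr (fun_of_multinom m _); apply: val_inj.
Qed.

Fact lazard_pre_eval_rel (R : comNzRingType) (F : fgl R) r :
  fgl_rel lazard_pre_series r -> lazard_pre_eval F r = 0.
Proof.
move=> /(fgl_rel_map (lazard_pre_eval F)); rewrite lazard_pre_evalE.
by move: (lazard_pre_eval F r); apply/fgl_relP; apply: fgl_seriesP.
Qed.

Fact lazard_proper : ~ ideal_gen (fgl_rel lazard_pre_series) 1.
Proof. exact: ideal_gen_proper (lazard_pre_eval_rel (fgl_add int)). Qed.

Definition lazard : comNzRingType := gquot lazard_proper.

Lemma fgl_rel_map_inv (R S : comNzRingType) (phi : {rmorphism R -> S})
    (F : {fps R[2]}) r :
  fgl_rel (fps_map phi F) r -> exists2 r', fgl_rel F r' & r = phi r'.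
Proof.
have E n (f : {fps R[n]}) m : phi (f m) = fps_map phi f m by [].
case=> m.
- exists ((fps_comp2 F (fpsX R (ord0 : 'I_1)) 0 - fpsX R ord0 : {fps R[1]}) m).
    exact: FglRelUnitR.
  by rewrite E fps_mapB fps_map_comp2 fps_mapX fps_map0.
- exists ((fps_comp2 F 0 (fpsX R (ord0 : 'I_1)) - fpsX R ord0 : {fps R[1]}) m).
    exact: FglRelUnitL.
  by rewrite E fps_mapB fps_map_comp2 fps_mapX fps_map0.
- exists ((fps_comp2 F (fpsX R (inord 1)) (fpsX R (inord 0)) - F) m).
    exact: FglRelComm.
  by rewrite E fps_mapB fps_map_comp2 !fps_mapX.
- have := FglRelAssoc F m; cbv zeta => r'P.
  exists ((fps_comp2 F (fps_comp2 F (fpsX R (inord 0 : 'I_3)) (fpsX R (inord 1)))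
                     (fpsX R (inord 2))
          - fps_comp2 F (fpsX R (inord 0))
                      (fps_comp2 F (fpsX R (inord 1)) (fpsX R (inord 2)))) m).
    exact: r'P.
  by rewrite E fps_mapB !fps_map_comp2 !fps_mapX.
Qed.

Fact lazard_fgl_axiom :
  fgl_axiom (fps_map (gquot_pi lazard_proper) lazard_pre_series).
Proof.
apply/fgl_relP => r /fgl_rel_map_inv[r' r'P ->].
rewrite -(rmorph0 (gquot_pi lazard_proper)); apply/gquot_piP.
by rewrite subr0; apply: ideal_gen_sub.
Qed.

Definition lazard_fgl : fgl lazard := Fgl lazard_fgl_axiom.

Definition lazard_classify (R : comNzRingType) (F : fgl R) :
    {rmorphism lazard -> R} :=
  gquot_lift (h := lazard_proper) (lazard_pre_eval_rel F).

Lemma lazard_classifyE (R : comNzRingType) (F : fgl R) :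
  fps_map (lazard_classify F) lazard_fgl = F.
Proof.
rewrite -[RHS](lazard_pre_evalE F); apply: fpsP => m.
exact: (gquot_lift_pi lazard_proper (lazard_pre_eval_rel F)).
Qed.

(* [GenB i j] is the generator b_(i+1,j): the first index of b is >= 1. *)
Inductive z2gen := GenU | GenQ of nat | GenB of nat & nat.

Definition z2gen_code (g : z2gen) : unit + nat + nat * nat :=
  match g with
  | GenU => inl (inl tt) | GenQ j => inl (inr j) | GenB i j => inr (i, j)
  end.
Definition z2gen_decode (c : unit + nat + nat * nat) : z2gen :=
  match c with
  | inl (inl _) => GenU | inl (inr j) => GenQ j | inr (i, j) => GenB i j
  end.
Fact z2gen_codeK : cancel z2gen_code z2gen_decode.
Proof. by case. Qed.
HB.instance Definition _ := Choice.copy z2gen (can_type z2gen_codeK).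

Definition z2pre : Type := polyring z2gen lazard.
HB.instance Definition _ := GRing.ComNzRing.on z2pre.

(* q_0, q_j - c_j - u q_(j+1) and b_ij - a_ij - u b_(i,j+1), with j >= 0 and
   i >= 1. *)
Inductive z2_rel : z2pre -> Prop :=
| Z2RelQ0 : z2_rel (pvar lazard (GenQ 0))
| Z2RelQ j : z2_rel
    (pvar lazard (GenQ j) - pconst z2gen (two_coef lazard_fgl j)
     - pvar lazard GenU * pvar lazard (GenQ j.+1))
| Z2RelB i j : z2_rel
    (pvar lazard (GenB i j) - pconst z2gen (fgl_coef lazard_fgl i.+1 j)
     - pvar lazard GenU * pvar lazard (GenB i j.+1)).

Lemma fps_comp_const (R : comNzRingType) k n (f : {fps R[k]})
    (g : 'I_k -> {fps R[n]}) : fps_const (fps_comp f g) = fps_const f.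
Proof.
rewrite /fps_const /=.
have h0 : (mdeg (0%MM : 'X_{1..k}) < (mdeg (0%MM : 'X_{1..n})).+1)%N.
  by rewrite mdeg0.
rewrite (bigD1 (BMultinom h0)) //= [X in _ + X]big1 ?addr0.
  rewrite big1 => [|i _]; last by rewrite mnm0E expr0.
  by rewrite /= eqxx mulr1.
move=> h /eqP[]; apply/eqP; rewrite bmeqP /= -mdeg_eq0 -leqn0 -ltnS.
by apply: leq_trans (bmdeg h) _; rewrite mdeg0.
Qed.

Lemma fgl_const0 (R : comNzRingType) (F : fgl R) : fps_const F = 0.
Proof.
have [F0 _ _ _] := fgl_seriesP F.
have := congr1 (@fps_const 1 R) F0; rewrite fps_comp_const => ->.
by rewrite /fps_const /= eq_sym mnm1_eq0.
Qed.

Lemma two_series_const0 (R : comNzRingType) (F : fgl R) :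
  fps_const (two_series F) = 0.
Proof. by rewrite fps_comp_const fgl_const0. Qed.

Lemma two_coef0 (R : comNzRingType) (F : fgl R) : two_coef F 0 = 0.
Proof.
rewrite -(two_series_const0 F); congr (fps_coef (two_series F) _).
apply/mnmP => i; rewrite multinomE (tnth_nth 0%N) mnm0E /=.
by case: i => -[].
Qed.

Fact z2_proper : ~ ideal_gen z2_rel 1.
Proof.
pose v (g : z2gen) : lazard := match g with
  | GenU => 0
  | GenQ j => two_coef lazard_fgl j
  | GenB i j => fgl_coef lazard_fgl i.+1 j
  end.
have [ev evV evC] : exists2 ev : {rmorphism z2pre -> lazard},
    forall g, ev (pvar lazard g) = v g & forall c, ev (pconst z2gen c) = c.
  exists (peval (idfun : {rmorphism lazard -> lazard}) v) => x.
    exact: peval_var.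
  exact: peval_const.
have evR a b c d : ev a = ev b -> ev c = 0 -> ev (a - b - c * d) = 0.
  by move=> ab c0; rewrite (rmorphB ev) (rmorphB ev) (rmorphM ev) ab c0 mul0r
    subrr subr0.
apply: (ideal_gen_proper (f := ev)) => _ [|j|i j].
- by rewrite evV; apply: two_coef0.
- apply: evR; last exact: evV.
  transitivity (two_coef lazard_fgl j); [exact: evV | exact/esym/evC].
- apply: evR; last exact: evV.
  transitivity (fgl_coef lazard_fgl i.+1 j); [exact: evV | exact/esym/evC].
Qed.

Definition MUZ2 : comNzRingType := gquot z2_proper.

Definition MUZ2_of_lazard : {rmorphism lazard -> MUZ2} :=
  gquot_pi z2_proper \o @pconst z2gen lazard.
Definition MUZ2_u : MUZ2 := gquot_pi z2_proper (pvar lazard GenU).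
Definition MUZ2_q (j : nat) : MUZ2 := gquot_pi z2_proper (pvar lazard (GenQ j)).
(* b_(i+1,j) *)
Definition MUZ2_b (i j : nat) : MUZ2 :=
  gquot_pi z2_proper (pvar lazard (GenB i j)).

(* A Z/2-equivariant formal group law over A, through the representability of
   these by MU^{Z/2}_*. *)
Definition Z2fgl (A : comNzRingType) : Type := {rmorphism MUZ2 -> A}.

(* t^(-1) F(t x, t y), i.e. a_ij is multiplied by t^(i+j-1); the truncated
   predecessor is harmless as a_00 = 0. *)
Definition fps_twist (R : comNzRingType) (t : R) n (f : {fps R[n]}) :
    {fps R[n]} :=
  Fps (fun m => t ^+ (mdeg m).-1 * f m).

Section Twist.
Variables (R : comNzRingType) (s t : R).
Hypothesis st1 : s * t = 1.

Let tI : injective ( *%R t).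
Proof. by move=> x y /(congr1 ( *%R s)); rewrite !mulrA st1 !mul1r. Qed.

Let twisted n d (f f' : {fps R[n]}) :=
  forall m, t ^+ d * f' m = t ^+ mdeg m * f m.

Let twisted1 n : twisted (n := n) 0 1 1.
Proof.
move=> m /=; have [->|_] := eqVneq m 0%MM; first by rewrite mdeg0.
by rewrite !mulr0.
Qed.

Let twistedM n d e (f f' g g' : {fps R[n]}) :
  twisted d f f' -> twisted e g g' -> twisted (d + e) (f * g) (f' * g').
Proof.
move=> ff' gg' m /=; rewrite !mulr_sumr; apply: eq_bigr => k /eqP mE.
have -> : t ^+ mdeg m = t ^+ mdeg k.1 * t ^+ mdeg k.2.
  by rewrite -exprD -mdegD -mE.
by rewrite exprD mulrACA ff' gg' mulrACA.
Qed.

Let twistedX n d e (f f' : {fps R[n]}) :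
  twisted d f f' -> twisted (d * e)%N (f ^+ e) (f' ^+ e).
Proof.
move=> ff'; elim: e => [|e IHe]; first by rewrite muln0 !expr0; apply: twisted1.
by rewrite mulnS !exprS; apply: twistedM.
Qed.

Let twisted_twist n (f : {fps R[n]}) :
  fps_const f = 0 -> twisted 1 f (fps_twist t f).
Proof.
move=> f0 m /=; have [m0|m_gt0] := posnP (mdeg m).
  have -> : m = 0%MM by apply/eqP; rewrite -mdeg_eq0 m0.
  by rewrite -[f _]/(fps_const f) f0 !mulr0.
by rewrite mulrA -exprD add1n prednK.
Qed.

Lemma fps_twist_comp k n (f : {fps R[k]}) (g : 'I_k -> {fps R[n]}) :
  fps_const f = 0 -> (forall i, fps_const (g i) = 0) ->
  fps_twist t (fps_comp f g)
  = fps_comp (fps_twist t f) (fun i => fps_twist t (g i)).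
Proof.
move=> f0 g0; apply: fpsP => m; apply: tI => /=; rewrite !mulr_sumr.
apply: eq_bigr => h _; have [h0|h_gt0] := posnP (mdeg h).
  have -> : f h = 0.
    rewrite -f0 /fps_const; congr (f _).
    by apply/eqP; rewrite -mdeg_eq0 h0.
  by rewrite !(mul0r, mulr0).
have m_gt0 : (0 < mdeg m)%N by rewrite (leq_trans h_gt0) // -ltnS bmdeg.
have tw : twisted (mdeg h) (\prod_(i < k) g i ^+ bmnm h i)
                  (\prod_(i < k) fps_twist t (g i) ^+ bmnm h i).
  rewrite mdegE; elim/big_ind3: _ => [|a b c a' b' c'|i _].
  - exact: twisted1.
  - exact: twistedM.
  - by have := twistedX (bmnm h i) (twisted_twist (g0 i)); rewrite mul1n.
rewrite !mulrA -!exprS !prednK // [RHS]mulrAC tw.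
by rewrite -!mulrA; congr (_ * _); rewrite mulrC.
Qed.

Let fps_twistX n i : fps_twist t (fpsX R i) = fpsX R i :> {fps R[n]}.
Proof.
apply: fpsP => m /=; have [->|_] := eqVneq m U_(i)%MM; last by rewrite mulr0.
by rewrite mdeg1 mulr1.
Qed.

Let fps_twist0 n : fps_twist t (0 : {fps R[n]}) = 0.
Proof. by apply: fpsP => m /=; rewrite mulr0. Qed.

Let fps_constX n (i : 'I_n) : fps_const (fpsX R i) = 0.
Proof. by rewrite /fps_const /= eq_sym mnm1_eq0. Qed.

Let fps_const0 n : fps_const (0 : {fps R[n]}) = 0. Proof. by []. Qed.

Let fps_twist_comp2 n (F : fgl R) (f g : {fps R[n]}) :
  fps_const f = 0 -> fps_const g = 0 ->
  fps_twist t (fps_comp2 F f g)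
  = fps_comp2 (fps_twist t F) (fps_twist t f) (fps_twist t g).
Proof.
move=> f0 g0; rewrite /fps_comp2 fps_twist_comp ?fgl_const0 //.
  by congr fps_comp; apply/funext => i; case: ifP.
by move=> i; case: ifP.
Qed.

Let fps_const_comp2 n (F : fgl R) (f g : {fps R[n]}) :
  fps_const (fps_comp2 F f g) = 0.
Proof. by rewrite fps_comp_const fgl_const0. Qed.

Fact fgl_twist_axiom (F : fgl R) : fgl_axiom (fps_twist t F).
Proof.
have [F0 F0' FC FA] := fgl_seriesP F; split.
- move: F0 => /(congr1 (fps_twist t (n := 1))).
  by rewrite fps_twist_comp2 // fps_twistX fps_twist0.
- move: F0' => /(congr1 (fps_twist t (n := 1))).
  by rewrite fps_twist_comp2 // fps_twistX fps_twist0.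
- move: FC => /(congr1 (fps_twist t (n := 2))).
  by rewrite fps_twist_comp2 // !fps_twistX.
- move: FA; cbv zeta => /(congr1 (fps_twist t (n := 3))).
  by rewrite !fps_twist_comp2 ?fps_const_comp2 // !fps_twistX.
Qed.

Definition fgl_twist (F : fgl R) : fgl R := Fgl (fgl_twist_axiom F).

End Twist.

Section Laurent.
Variable R : comNzRingType.

(* R[t, t^-1], presented as R[t][t']/(t t' - 1). *)
Definition laurent_rel : set {poly {poly R}} := [set 'X%:P * 'X - 1].

Fact laurent_proper : ~ ideal_gen laurent_rel 1.
Proof.
apply: (ideal_gen_proper (f := horner_eval (1 : R) \o horner_eval (1 : {poly R}))).
move=> _ ->; rewrite /= /horner_eval.
by rewrite !hornerE subrr.
Qed.

Definition laurent : comNzRingType := gquot laurent_proper.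

Definition laurent_t : laurent := gquot_pi laurent_proper 'X%:P.
Definition laurent_tV : laurent := gquot_pi laurent_proper 'X.
Definition laurentC : {rmorphism R -> laurent} :=
  gquot_pi laurent_proper \o (polyC \o polyC).

Lemma laurent_tVt : laurent_tV * laurent_t = 1.
Proof.
rewrite -rmorphM -(rmorph1 (gquot_pi laurent_proper)); apply/gquot_piP.
by apply: ideal_gen_sub; rewrite mulrC.
Qed.

End Laurent.

(* [2](x) = v x^(2^n) + higher order terms with v != 0. *)
Definition has_height_at2 (k : fieldType) (G : fgl k) (n : nat) : Prop :=
  (forall j, (j < 2 ^ n)%N -> two_coef G j = 0) /\ two_coef G (2 ^ n) != 0.

Section Adic.
Variable R : comNzRingType.

Definition ideal_exp (I : set R) (k : nat) : set R := ideal_gen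
  [set x | exists s : seq R,
    [/\ size s = k, forall y, y \in s -> I y & x = \prod_(y <- s) y]].

(* R is separated and complete for the I-adic topology. *)
Definition adically_complete (I : set R) : Prop :=
  (forall x, (forall k, ideal_exp I k x) -> x = 0) /\
  (forall v : nat -> R, (forall k, ideal_exp I k (v k.+1 - v k)) ->
     exists l, forall k, ideal_exp I k (l - v k)).

Definition noetherian : Prop := forall I : set R,
  I 0 -> (forall a x y, I x -> I y -> I (a * x + y)) ->
  exists s : seq R, I = ideal_gen [set` s].

End Adic.

Definition rker (R S : comNzRingType) (f : {rmorphism R -> S}) : set R :=
  [set x | f x = 0].

(* W is a strict p-ring with residue field k via res; for k perfect of
   characteristic p this characterizes the ring of Witt vectors W(k). *)
Definition is_witt_ring (p : nat) (k : fieldType) (W : comNzRingType)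
    (res : {rmorphism W -> k}) : Prop :=
  [/\ forall a, exists x, res x = a,
      forall x, res x = 0 <-> exists y, x = p%:R * y,
      forall x : W, p%:R * x = 0 -> x = 0
    & adically_complete (rker res)].

(* B is a complete Noetherian local ring with residue field l via rho. *)
Definition complete_local (l : fieldType) (B : comNzRingType)
    (rho : {rmorphism B -> l}) : Prop :=
  [/\ forall a, exists x, rho x = a,
      forall x, rho x != 0 -> exists y, x * y = 1,
      noetherian B & adically_complete (rker rho)].

(* f : G -> G' is an isomorphism reducing to the identity modulo ker rho. *)
Definition star_iso (l : fieldType) (B : comNzRingType)
    (rho : {rmorphism B -> l}) (G G' : fgl B) (f : {fps B[1]}) : Prop :=
  let f_ (i : 'I_2) : {fps B[2]} := fps_comp f (fun=> fpsX B i) in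
  [/\ fps_const f = 0, fps_map rho f = fpsX l ord0
    & fps_comp f (fun=> fgl_series G) = fps_comp2 G' (f_ ord0) (f_ ord_max)].

(* (E0, F), with residue field k via res, is a universal deformation of the
   formal group law G over k: every deformation of G to a complete Noetherian
   local ring B with residue field l is star-isomorphic to a push-forward of F
   along a unique local homomorphism, by a unique star-isomorphism. *)
Definition universal_deformation (k : fieldType) (G : fgl k)
    (E0 : comNzRingType) (res : {rmorphism E0 -> k}) (F : fgl E0) : Prop :=
  fps_map res F = G /\
  forall (l : fieldType) (B : comNzRingType) (rho : {rmorphism B -> l})
    (iota : {rmorphism k -> l}) (H : fgl B),
  complete_local rho -> fps_map rho H = fps_map iota G ->
  exists (psi : {rmorphism E0 -> B}) (f : {fps B[1]}),
    [/\ forall x, rho (psi x) = iota (res x), star_iso rho (fgl_map psi F) H f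
      & forall (psi' : {rmorphism E0 -> B}) (f' : {fps B[1]}),
          (forall x, rho (psi' x) = iota (res x)) ->
          star_iso rho (fgl_map psi' F) H f' -> psi' =1 psi /\ f' = f].

(* W[[u_1, ..., u_(n-1)]] *)
Definition LT_ring0 (W : comNzRingType) (n : nat) : comNzRingType :=
  {fps W[n.-1]}.

Definition LT_res (k : fieldType) (W : comNzRingType) (n : nat)
    (res : {rmorphism W -> k}) : {rmorphism LT_ring0 W n -> k} :=
  res \o @fps_const n.-1 W.

(* W[[u_1, ..., u_(n-1)]][t, t^-1] *)
Definition LT_ring (W : comNzRingType) (n : nat) : comNzRingType :=
  laurent (LT_ring0 W n).

(* With |t| = 2 the coefficient a_ij has degree 2(i+j-1), so the law over
   E_n is t^(-1) F(t x, t y) and MU_* -> E_n preserves degrees. *)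
Definition LT_fgl (W : comNzRingType) (n : nat) (F : fgl (LT_ring0 W n)) :
    fgl (LT_ring W n) :=
  fgl_twist (laurent_tVt (LT_ring0 W n))
            (fgl_map (laurentC (LT_ring0 W n)) F).

(* \sum_k c_k u^k in R[[u]] *)
Definition fps1 (R : Type) (c : nat -> R) : {fps R[1]} :=
  Fps (fun m => c (mdeg m)).

Section Deformation.
Variables (R : comNzRingType) (F : fgl R).

Definition fps_u : {fps R[1]} := fpsX R ord0.
Definition b_series (i j : nat) : {fps R[1]} :=
  fps1 (fun k => fgl_coef F i (k + j)).
Definition q_series (j : nat) : {fps R[1]} :=
  fps1 (fun k => two_coef F (k + j)).

(* R[[u]] / ([2]u) *)
Fact borel_proper : ~ ideal_gen [set two_series F] 1.
Proof.
apply: (ideal_gen_proper (f := @fps_const 1 R)) => _ ->.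
exact: two_series_const0.
Qed.

Definition borel_ring : comNzRingType := gquot borel_proper.
Definition to_borel : {rmorphism {fps R[1]} -> borel_ring} :=
  gquot_pi borel_proper.

(* R[[u]][w] / ([2]u (1 - u w)) *)
Definition deform_rel : {poly {fps R[1]}} :=
  (two_series F)%:P * (1 - fps_u%:P * 'X).

Fact deform_proper : ~ ideal_gen [set deform_rel] 1.
Proof.
apply: (ideal_gen_proper
  (f := @fps_const 1 R \o horner_eval (0 : {fps R[1]}))) => _ ->.
have hE : horner_eval 0 deform_rel = two_series F.
  by rewrite /horner_eval /deform_rel !hornerE subr0 mulr1.
exact: etrans (congr1 (@fps_const 1 R) hE) (two_series_const0 F).
Qed.

Definition deform_ring : comNzRingType := gquot deform_proper.
Definition to_deform : {rmorphism {poly {fps R[1]}} -> deform_ring} :=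
  gquot_pi deform_proper.

Fact deform_w0_rel (p : {poly {fps R[1]}}) : [set deform_rel] p ->
  (to_borel \o horner_eval (0 : {fps R[1]})) p = 0.
Proof.
have hE : horner_eval 0 deform_rel = two_series F.
  by rewrite /horner_eval /deform_rel !hornerE subr0 mulr1.
move=> ->; apply: etrans (congr1 to_borel hE) _.
rewrite -(rmorph0 to_borel); apply/gquot_piP.
by rewrite subr0; apply: ideal_gen_sub.
Qed.

Definition deform_w0 : {rmorphism deform_ring -> borel_ring} :=
  gquot_lift (h := deform_proper) deform_w0_rel.

(* The Z/2-equivariant law over A obtained from the classifying map of F
   along e : R -> A, with Euler class u and the given images of b_(i+1,j)
   and q_j. *)
Definition classified_by (A : comNzRingType) (e : R -> A)
    (u : A) (b : nat -> nat -> A) (q : nat -> A) (phi : Z2fgl A) : Prop :=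
  [/\ forall x, phi (MUZ2_of_lazard x) = e (lazard_classify F x),
      phi MUZ2_u = u,
      forall i j, phi (MUZ2_b i j) = b i j
    & forall j, phi (MUZ2_q j) = q j].

Definition fps1C (c : R) : {fps R[1]} := Fps (fun m => c *+ (m == 0%MM)).

Definition is_borel_law (phi : Z2fgl borel_ring) : Prop :=
  classified_by (fun c => to_borel (fps1C c)) (to_borel fps_u)
    (fun i j => to_borel (b_series i.+1 j))
    (fun j => to_borel (q_series j)) phi.

Definition is_deformed_law (phi : Z2fgl deform_ring) : Prop :=
  classified_by (fun c => to_deform (fps1C c)%:P) (to_deform fps_u%:P)
    (fun i j => to_deform (b_series i.+1 j)%:P)
    (fun j => to_deform ((q_series j)%:P - 'X^j * (two_series F)%:P)) phi.

End Deformation.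

Definition Spec (A : comNzRingType) : Type := prime_idealr A.

HB.instance Definition _ A := gen_eqMixin (Spec A).
HB.instance Definition _ A := gen_choiceMixin (Spec A).

Section Zariski.
Variable A : comNzRingType.

Definition zariski_closed (S : set A) : set (Spec A) :=
  [set P : Spec A | forall x, S x -> x \in (P : prime_idealr A)].

Definition zariski_open : set (set (Spec A)) :=
  [set U | exists S, U = ~` zariski_closed S].

Fact zariski_openT : zariski_open setT.
Proof.
exists [set 1]; apply/seteqP; split=> // P _ /(_ 1 erefl).
by rewrite idealr1.
Qed.

Fact zariski_openI : setI_closed zariski_open.
Proof.
move=> _ _ [S ->] [T ->].
exists [set x | exists s t, [/\ S s, T t & x = s * t]].
apply/seteqP; split=> P /=.
  move=> [nS nT] ST; apply: nS => s Ss; apply: contrapT => sP.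
  apply: nT => t Tt; have := ST (s * t).
  rewrite prime_idealrM => /(_ _)/orP[|//|//].
  by exists s, t.
move=> nST; split=> [SP|TP]; apply: nST => _ [s [t [Ss Tt ->]]].
  by rewrite prime_idealrM (SP s Ss).
by rewrite prime_idealrM (TP t Tt) orbT.
Qed.

Fact zariski_open_bigU (I : Type) (U : I -> set (Spec A)) :
  (forall i, zariski_open (U i)) -> zariski_open (\bigcup_i U i).
Proof.
move=> /choice[S US]; exists (\bigcup_i S i); apply/seteqP; split=> P /=.
  by move=> [i _]; rewrite US => nSP SP; apply: nSP => x Sx; apply: SP; exists i.
move=> nSP; apply: contrapT => nU; apply: nSP => x [i _ Six].
apply: contrapT => xP; apply: nU; exists i => //.
by rewrite US => SP; apply/xP/SP.
Qed.

HB.instance Definition _ := isOpenTopological.Build (Spec A)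
  zariski_openT zariski_openI zariski_open_bigU.

End Zariski.

(* Main.v *)
Require Import Defs.
From HB Require Import structures.
From mathcomp Require Import all_boot all_order all_algebra.
From mathcomp Require Import finmap.
From mathcomp Require Import -(notations) monalg.
From mathcomp Require Import mpoly.
From mathcomp Require Import all_classical.
From mathcomp Require Import topology.

(* Existence and uniqueness of the laws are checks on the generators: the two
   corrections w^j [2]u cancel in q_j - c_j - u q_(j+1) because
   [2]u (1 - u w) = 0.

   For connectedness, write R for E_n and f for [2]u; Spec of the
   deformation ring is V(1 - u w) U V(f). The ring R is a domain, so
   V(1 - u w) = Spec R((u)) is irreducible. In V(f) = Spec (R[[u]]/f)[w] every
   point specializes, up to passing to the extension of its contraction to
   R[[u]], to a point containing u, because u lies in the Jacobson radical of
   R[[u]]; and V(u) = Spec R[w] is irreducible. The two pieces meet: otherwise f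
   would divide a power of u, which is impossible as f = 2u + ... where 2 is
   neither a unit nor a zero divisor. *)

Set Implicit Arguments.
Unset Strict Implicit.
Unset Printing Implicit Defensive.

Import GRing.Theory.
Local Open Scope ring_scope.
Local Open Scope classical_set_scope.

(** * Coefficients of power series *)

Section FpsCoef.
Variables (n : nat) (R : comNzRingType).
Implicit Types f g h : {fps R[n]}.

Lemma fps_coefB f g m : (f - g) m = f m - g m. Proof. by []. Qed.

Lemma fps_coef0 m : (0 : {fps R[n]}) m = 0. Proof. by []. Qed.

Lemma fps_coef1 m : (1 : {fps R[n]}) m = (m == 0%MM)%:R. Proof. by []. Qed.

Lemma fps_coef_sum I (r : seq I) (P : pred I) (f : I -> {fps R[n]}) m :
  (\sum_(i <- r | P i) f i) m = \sum_(i <- r | P i) f i m.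
Proof. exact: (big_morph (fun f => fps_coef f m) (fun f g => erefl)). Qed.

Lemma fps_coefM f g m : (f * g) m =
  \sum_(k : 'X_{1..n < (mdeg m).+1, (mdeg m).+1} | m == (k.1 + k.2)%MM)
    f k.1 * g k.2.
Proof. by []. Qed.

Lemma fps_coefM_eq0 f g m :
  (forall a b, (a + b)%MM = m -> f a * g b = 0) -> (f * g) m = 0.
Proof. by move=> fg0; rewrite fps_coefM big1 // => k /eqP/esym/fg0. Qed.

Lemma fps_coefM_eq f g f' g' m :
  (forall a b, (a + b)%MM = m -> f a * g b = f' a * g' b) ->
  (f * g) m = (f' * g') m.
Proof. by move=> E; rewrite !fps_coefM; apply: eq_bigr => k /eqP/esym/E. Qed.

(** Testing [a' != a] suffices: monomials cancel, so [a' = a] forces [b' = b], and one term of the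
    Cauchy product survives. *)
Lemma fps_coefM_single f g a b :
  (forall a' b', (a' + b')%MM = (a + b)%MM -> a' != a -> f a' * g b' = 0) ->
  (f * g) (a + b)%MM = f a * g b.
Proof.
move=> fg0; have da : (mdeg a < (mdeg (a + b)).+1)%N by rewrite ltnS mdegD leq_addr.
have db : (mdeg b < (mdeg (a + b)).+1)%N by rewrite ltnS mdegD leq_addl.
rewrite fps_coefM (bigD1 (BMultinom da, BMultinom db)) //= big1 ?addr0 // => -[k1 k2] /=.
case/andP=> /eqP kE kne; apply: fg0; first exact: esym kE.
apply: contra kne => /eqP ka; move: (kE); rewrite ka => /addmI kb.
by rewrite -pair_eqE /= !bmeqP /= ka -kb !eqxx.
Qed.

Lemma fps_constE f : fps_const f = f 0%MM. Proof. by []. Qed.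

Lemma fps_coefXM i g m : (fpsX R i * g) (U_(i) + m)%MM = g m.
Proof.
rewrite fps_coefM_single /= ?eqxx ?mul1r // => a b _ ai.
by rewrite (negPf ai) mul0r.
Qed.

Lemma fps_constX (i : 'I_n) : fps_const (fpsX R i) = 0.
Proof. by rewrite /fps_const /= eq_sym mnm1_eq0. Qed.

Lemma fps_order_exp f k m : fps_const f = 0 -> (mdeg m < k)%N -> (f ^+ k) m = 0.
Proof.
move=> f0; elim: k m => // k IHk m; rewrite ltnS => mk.
rewrite exprS; apply: fps_coefM_eq0 => a b abm.
have [a0|a_gt0] := posnP (mdeg a).
  have -> : a = 0%MM by apply/eqP; rewrite -mdeg_eq0 a0.
  by rewrite -fps_constE f0 mul0r.
rewrite IHk ?mulr0 // (leq_trans _ mk) // -abm mdegD.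
by rewrite -[X in (X < _)%N]add0n ltn_add2r.
Qed.

(* The inverse is the geometric series in 1 - f, each coefficient of which is a
   finite sum. *)
Lemma fps_inv f : fps_const f = 1 -> exists g, f * g = 1.
Proof.
move=> f1; pose y := 1 - f.
have y0 : fps_const y = 0 
  by rewrite fps_constE fps_coefB fps_coef1 eqxx -fps_constE f1 subrr.
exists (Fps (fun m => (\sum_(k < (mdeg m).+1) y ^+ k) m)); apply: fpsP => m.
(* Each coefficient of the candidate inverse is truncated at its own degree; raising the bound to
   [mdeg m] only adds powers of [y] of too high order to contribute. *)
transitivity ((f * \sum_(k < (mdeg m).+1) y ^+ k) m).
  apply: fps_coefM_eq => a b abm; congr (_ * _) => /=.
  rewrite !fps_coef_sum -!(big_mkord xpredT (fun k => (y ^+ k) b)).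
  have bm : ((mdeg b).+1 <= (mdeg m).+1)%N by rewrite ltnS -abm mdegD leq_addl.
  rewrite (big_cat_nat (leq0n _) bm) //= [X in _ + X]big_nat [X in _ + X]big1 ?addr0 //.
  by move=> k /andP[bk _]; apply: fps_order_exp.
have -> : f = 1 - y by rewrite /y opprB addrC subrK.
rewrite -[X in X * _]opprB mulNr -subrX1 opprB fps_coefB fps_order_exp ?subr0 //.
Qed.

End FpsCoef.

Lemma fpsX_nreg n (R : comNzRingType) (i : 'I_n) (g : {fps R[n]}) :
  fpsX R i * g = 0 -> g = 0.
Proof. by move=> Xg; apply: fpsP => m; rewrite -(fps_coefXM i) Xg. Qed.

Lemma mnm_ord1 (m : 'X_{1..1}) : m = [multinom [tuple mdeg m]].
Proof.
apply/mnmP => i; rewrite multinomE (tnth_nth 0%N) mdegE big_ord1 /=.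
by rewrite (ord1 i).
Qed.

Lemma mnm_ord1_eq (a b : 'X_{1..1}) : mdeg a = mdeg b -> a = b.
Proof. by move=> ab; rewrite (mnm_ord1 a) ab -mnm_ord1. Qed.

Lemma fps1_factor (R : comNzRingType) (f : {fps R[1]}) : fps_const f = 0 ->
  f = fpsX R ord0 * Fps (fun m => f (U_(ord0) + m)%MM).
Proof.
move=> f0; apply: fpsP => m; have [m0|m_gt0] := posnP (mdeg m).
  have -> : m = 0%MM by apply/eqP; rewrite -mdeg_eq0 m0.
  by rewrite -!fps_constE f0 [RHS](rmorphM (@fps_const _ R)) [X in X * _]fps_constX mul0r.
have -> : m = (U_(ord0) + [multinom [tuple (mdeg m).-1]])%MM.
  apply: mnm_ord1_eq; rewrite mdegD mdeg1 [in RHS]mdegE big_ord1.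
  by rewrite -[RHS]/(1 + (mdeg m).-1)%N add1n prednK.
by rewrite fps_coefXM.
Qed.

(** * Integral domains *)

Definition is_domain (R : comNzRingType) : Prop :=
  forall x y : R, x * y = 0 -> x = 0 \/ y = 0.

(* The product of the lowest terms of f and g, for the monomial order, is the
   lowest term of f * g. *)
Lemma fps_domain n (R : comNzRingType) : is_domain R -> is_domain {fps R[n]}.
Proof.
move=> domR f g fg0.
have low (h : {fps R[n]}) : h <> 0 ->
    exists2 m, h m <> 0 & forall k : 'X_{1..n}, (k < m)%O -> h k = 0.
  move=> h0; apply: contrapT => nlow; apply: h0; apply: fpsP => m.
  rewrite fps_coef0; move: m; apply: ltmwf => m IHm.
  apply: contrapT => hm; apply: nlow; exists m => // k km; exact: IHm.
have [->|/low[a fa fl]] := pselect (f = 0); first by left.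
have [->|/low[b gb gl]] := pselect (g = 0); first by right.
have : (f * g) (a + b)%MM = f a * g b.
  apply: fps_coefM_single => a' b' abE /eqP aa'.
  have [lt|ge] := boolP (a' < a)%O; first by rewrite fl ?mul0r.
  have [lt'|ge'] := boolP (b' < b)%O; first by rewrite gl ?mulr0.
  exfalso; move: ge ge'; rewrite -!Order.TotalTheory.leNgt => ge ge'.
  have gt : (a < a')%O by rewrite Order.POrderTheory.lt_neqAle ge andbT eq_sym; apply/eqP.
  by have := ltmc_le_add gt ge'; rewrite abE Order.POrderTheory.ltxx.
by rewrite fg0 fps_coef0 => /esym/domR[].
Qed.

Lemma poly_domain (R : comNzRingType) : is_domain R -> is_domain {poly R}.
Proof.
move=> domR p q pq0.
have [->|p0] := eqVneq p 0; [by left | right; apply/eqP/contraT => q0].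
have [c0|/lead_coef_proper_mul] := eqVneq (lead_coef p * lead_coef q) 0.
  by case/domR: c0 => /eqP; rewrite lead_coef_eq0 ?(negPf p0) ?(negPf q0).
rewrite pq0 lead_coef0 => /esym/domR[] /eqP;
  by rewrite lead_coef_eq0 ?(negPf p0) ?(negPf q0).
Qed.

Lemma ideal_gen1P (R : comNzRingType) (r x : R) :
  ideal_gen [set r] x <-> exists y, x = y * r.
Proof.
split=> [[s [sr ->]]|[y ->]].
  exists (\sum_(p <- s) p.1); rewrite mulr_suml big_seq [RHS]big_seq.
  by apply: eq_bigr => p /sr ->.
by exists [:: (y, r)]; rewrite big_seq1; split=> // p; rewrite inE => /eqP ->.
Qed.

(** * Localization of a domain at one element *)

Section InvertElement.
Variables (S : comNzRingType) (a : S).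
Hypotheses (domS : is_domain S) (a_neq0 : a <> 0).

Let rel : set {poly S} := [set a%:P * 'X - 1].

(** In a nonzero multiple [y * (a X - 1)] the coefficient in degree [size y] is [a] times the
    leading coefficient of [y], nonzero in a domain, whereas a constant has none there. Hence [S]
    embeds in [S[1/a]]. *)
Lemma invert_rel_const (c : S) : ideal_gen rel c%:P -> c = 0.
Proof.
move=> /ideal_gen1P[y cE]; have [y0|y0] := eqVneq y 0.
  by apply/eqP; rewrite -polyC_eq0 cE y0 mul0r.
have sy : (0 < size y)%N by rewrite size_poly_gt0.
have := congr1 (fun p : {poly S} => p`_(size y)) cE.
rewrite coefC (negPf (lt0n_neq0 sy)) mulrBr mulr1 mulrA coefB coefMX.
rewrite (negPf (lt0n_neq0 sy)) coefMC [y`_(size y)]nth_default // subr0.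
move=> /esym/domS[/eqP|//]; rewrite -[_`_ _]/(lead_coef y) lead_coef_eq0.
by rewrite (negPf y0).
Qed.

Lemma invert_proper : ~ ideal_gen rel 1.
Proof. by move=> /(@invert_rel_const 1)/eqP; rewrite oner_eq0. Qed.

Variable h : ~ ideal_gen rel 1.
Let pi : {rmorphism {poly S} -> gquot h} := gquot_pi h.

Let piaX : pi a%:P * pi 'X = 1.
Proof.
rewrite -rmorphM -(rmorph1 pi); apply/gquot_piP; exact: ideal_gen_sub.
Qed.

Let piC0 c : pi c%:P = 0 -> c = 0.
Proof.
rewrite -(rmorph0 pi) => /gquot_piP; rewrite subr0; exact: invert_rel_const.
Qed.

(** Clearing denominators: [X] is the inverse of [a] in the quotient. *)
Let pi_reduce (p : {poly S}) : exists N c, pi a%:P ^+ N * pi p = pi c%:P.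
Proof.
elim/poly_ind: p => [|p c [N [d pE]]].
  by exists 0%N, 0; rewrite expr0 mul1r polyC0.
exists N.+1, (d + a ^+ N.+1 * c).
rewrite !(rmorphD, rmorphM, rmorphXn) /= mulrDr; congr (_ + _).
by rewrite exprSr mulrACA piaX mulr1.
Qed.

Let pi_cancel N x : pi a%:P ^+ N * x = 0 -> x = 0.
Proof.
move=> ax0; rewrite -[x]mul1r -(expr1n _ N) -piaX exprMn_comm; last exact: mulrC.
by rewrite mulrAC ax0 mul0r.
Qed.

(** Once denominators are cleared, a zero product becomes one in [S]; the powers of the unit [a]
    then cancel. *)
Lemma invert_domain : is_domain (gquot h).
Proof.
move=> x y; have [[p <-] [q <-]] := (gquot_pi_surj x, gquot_pi_surj y).
rewrite -[gquot_pi h p]/(pi p) -[gquot_pi h q]/(pi q) => pq0.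
have [[N [c pE]] [M [d qE]]] := (pi_reduce p, pi_reduce q).
have : pi (c * d)%:P = 0 by rewrite polyCM rmorphM -pE -qE mulrACA pq0 mulr0.
move=> /piC0/domS[c0|d0]; [left|right].
  by apply: (@pi_cancel N); rewrite pE c0 polyC0 rmorph0.
by apply: (@pi_cancel M); rewrite qE d0 polyC0 rmorph0.
Qed.

End InvertElement.

Lemma laurent_domain (R : comNzRingType) : is_domain R -> is_domain (laurent R).
Proof.
move=> /poly_domain domS; apply: invert_domain => //.
by apply/eqP; rewrite polyX_eq0.
Qed.

(** By separatedness every nonzero element is a power of [p] times an element of nonzero residue.
    Such residues have nonzero product in the field [k], and [p] is a non-zero-divisor. *)
Lemma witt_domain p (k : fieldType) (W : comNzRingType)
  (res : {rmorphism W -> k}) : p%:R = 0 :> k ->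
  is_witt_ring p res -> is_domain W.
Proof.
move=> p0 [_ resP pI [sep _]] x y xy0.
have pkI j (z : W) : p%:R ^+ j * z = 0 -> z = 0.
  by elim: j z => [|j IHj] z; rewrite ?expr0 ?mul1r // exprSr -mulrA => /IHj/pI.
have val (z : W) : z <> 0 -> exists j z', z = p%:R ^+ j * z' /\ res z' <> 0.
  move=> z0; apply: contrapT => nval; apply: z0; apply: sep => j.
  have [z' ->] : exists z', z = p%:R ^+ j * z'.
    elim: j => [|j [z' zE]]; first by exists z; rewrite expr0 mul1r.
    have /resP[t tE] : res z' = 0.
      by apply: contrapT => z'0; apply: nval; exists j, z'.
    by exists t; rewrite exprSr -mulrA -tE.
  (* As [p] vanishes in [k], it lies in the kernel of [res], so [p^j] is a product of [j] elements
     of that ideal. *)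
  exists [:: (z', p%:R ^+ j)]; split; last by rewrite big_seq1 mulrC.
  move=> _ /predU1P[->|//]; exists (nseq j p%:R).
  rewrite size_nseq big_nseq iter_mulr_1.
  by split=> // w /nseqP[-> _]; rewrite /rker /= rmorph_nat.
have [->|/val[i [x' [xE x'0]]]] := pselect (x = 0); first by left.
have [->|/val[j [y' [yE y'0]]]] := pselect (y = 0); first by right.
have : x' * y' = 0 by apply: (@pkI (i + j)); rewrite exprD mulrACA -xE -yE.
by move=> /(congr1 res)/eqP; rewrite rmorphM rmorph0 mulf_eq0 => /orP[]/eqP.
Qed.

(** * The leading term of the 2-series *)

(** At a monomial of degree one, the sum defining [fps_comp] runs over exponents of degree at most
    one, and the exponent zero carries the constant term of [f]. *)
Lemma fps_comp_linear (R : comNzRingType) k n (f : {fps R[k]})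
    (g : 'I_k -> {fps R[n]}) m : fps_const f = 0 -> mdeg m = 1%N ->
  fps_comp f g m = \sum_(i < k) f U_(i)%MM * g i m.
Proof.
move=> f0 m1; pose F (h : 'X_{1..k}) := f h * (\prod_(i < k) g i ^+ h i) m.
have FU i : F U_(i)%MM = f U_(i)%MM * g i m.
  rewrite /F; congr (_ * fps_coef _ m).
  rewrite (bigD1 i) //= mnm1E eqxx expr1 big1 ?mulr1 //.
  by move=> j ji; rewrite mnm1E eq_sym (negPf ji) expr0.
(* Each term is spread over the index [i] of its variable, with at most one nonzero entry, so that
   the two sums can be exchanged. *)
transitivity (\sum_(h : 'X_{1..k < (mdeg m).+1}) \sum_(i < k)
    if bmnm h == U_(i)%MM then F U_(i)%MM else 0).
  apply: eq_bigr => h _; rewrite -/(F h).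
  have := bmdeg h; rewrite [X in (_ < X.+1)%N]m1 ltnS leq_eqVlt => /orP[].
    rewrite mdeg_eq1 => /existsP[i /eqP ->].
    rewrite (bigD1 i) //= eqxx big1 ?addr0 // => j ji.
    by rewrite eq_mnm1 eq_sym (negPf ji).
  rewrite ltnS leqn0 mdeg_eq0 => /eqP ->.
  rewrite /F -fps_constE f0 mul0r big1 // => i _.
  by rewrite eq_sym mnm1_eq0.
rewrite exchange_big; apply: eq_bigr => i _.
have iP : (mdeg U_(i)%MM < (mdeg m).+1)%N by rewrite mdeg1 m1.
rewrite (bigD1 (BMultinom iP)) //= eqxx FU big1 ?addr0 // => h hi.
have [hE|//] := eqVneq (bmnm h) U_(i)%MM.
by case/eqP: hi; apply/eqP; rewrite bmeqP /= hE.
Qed.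

(** The unit axioms make both linear coefficients of [F] equal to 1, and the linear coefficient of
    [F(x, x)] is their sum. *)
Lemma two_coef1 (R : comNzRingType) (F : fgl R) :
  two_series F U_(ord0)%MM = 2%:R.
Proof.
have m1 : mdeg (U_(ord0) : 'X_{1..1})%MM = 1%N by rewrite mdeg1.
have XU : fpsX R ord0 (U_(ord0) : 'X_{1..1})%MM = 1 by rewrite /= eqxx.
have [Fx Fy _ _] := fgl_seriesP F.
have := congr1 (fun f => fps_coef f U_(ord0)%MM) Fx.
have := congr1 (fun f => fps_coef f U_(ord0)%MM) Fy.
rewrite /two_series /fps_comp2 !(fps_comp_linear _ (fgl_const0 F) m1).
rewrite !big_ord_recr !big_ord0 /= !add0r eqxx !mulr1 !mulr0 addr0 add0r.
by move=> -> ->.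
Qed.

(* As [2]u = 2u + ..., an equation u^N = g [2]u makes 2 a unit if N = 1, and
   makes g divisible by u, which lowers N, if N > 1. *)
Lemma two_series_no_power (R : comNzRingType) (F : fgl R) :
  is_domain R -> 2%:R <> 0 :> R -> (forall x : R, 2%:R * x <> 1) ->
  forall N g, fps_u R ^+ N <> g * two_series F.
Proof.
move=> domR two0 twoU; set f := two_series F.
have f0 : fps_const f = 0 := two_series_const0 F.
have [f1 fE f10] : exists2 f1, f = fps_u R * f1 & fps_const f1 = 2%:R.
  eexists; first exact: fps1_factor f0.
  by rewrite fps_constE -[LHS]/(f (U_(ord0) + 0)%MM) addm0 two_coef1.
have constM (x y : {fps R[1]}) : fps_const (x * y) = fps_const x * fps_const y.
  exact: (rmorphM (@fps_const 1 R)).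
elim=> [|N IHN] g gE.
  have := congr1 (@fps_const 1 R) gE.
  rewrite constM f0 mulr0 expr0 fps_constE fps_coef1 eqxx => /eqP.
  by rewrite oner_eq0.
have {}gE : fps_u R ^+ N = g * f1.
  apply/eqP; rewrite -subr_eq0; apply/eqP; apply: (@fpsX_nreg _ _ ord0).
  by rewrite mulrBr -exprS gE fE mulrCA subrr.
case: N IHN gE => [|N] IHN gE.
  apply: (twoU (fps_const g)); rewrite mulrC -f10 -constM -gE.
  by rewrite expr0 fps_constE fps_coef1 eqxx.
have /fps1_factor g'E : fps_const g = 0.
  have := congr1 (@fps_const 1 R) gE.
  rewrite exprS !constM f10 fps_constX mul0r => /esym/domR[//|/two0[]].
apply: (IHN (Fps (fun m => g (U_(ord0) + m)%MM))).
by rewrite gE [in LHS]g'E fE mulrAC [RHS]mulrC -!mulrA [X in _ * X]mulrC.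
Qed.

(** * Prime ideals and points of the spectrum *)

(** Ideals and primes are handled as plain sets, convenient for preimages and Zorn's lemma;
    [prime_point] later turns a prime set into a point of [Spec]. *)
Definition is_ideal (R : comNzRingType) (I : set R) : Prop :=
  I 0 /\ forall a x y, I x -> I y -> I (a * x + y).

Definition is_prime (R : comNzRingType) (P : set R) : Prop :=
  [/\ is_ideal P, ~ P 1 & forall x y, P (x * y) -> P x \/ P y].

Lemma idealDl (R : comNzRingType) (I : set R) x y :
  is_ideal I -> I x -> I y -> I (x + y).
Proof. by move=> [_ IP] Ix Iy; rewrite -[x]mul1r; apply: IP. Qed.

Lemma idealMl (R : comNzRingType) (I : set R) a x :
  is_ideal I -> I x -> I (a * x).
Proof. by move=> [I0 IP] Ix; rewrite -[a * x]addr0; apply: IP. Qed.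

Lemma ideal_gen_least (R : comNzRingType) (S I : set R) :
  is_ideal I -> S `<=` I -> ideal_gen S `<=` I.
Proof.
move=> idI SI _ [s [sS ->]]; rewrite big_seq; apply: big_ind.
- by case: idI.
- by move=> x y; apply: idealDl.
- by move=> p /sS/SI; apply: idealMl.
Qed.

Lemma ideal_gen_ideal (R : comNzRingType) (S : set R) : is_ideal (ideal_gen S).
Proof.
split=> [|a _ _ [s [sS ->]] [t [tS ->]]]; first by exists [::]; rewrite big_nil.
exists ([seq (a * p.1, p.2) | p <- s] ++ t); split=> [p|].
  by rewrite mem_cat => /orP[/mapP[q qs ->]|/tS//]; apply: (sS q qs).
rewrite big_cat big_map mulr_sumr; congr (_ + _).
by apply: eq_bigr => p _; rewrite mulrA.
Qed.

Lemma preimage_prime (R S : comNzRingType) (f : {rmorphism R -> S}) (P : set S) :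
  is_prime P -> is_prime (f @^-1` P).
Proof.
move=> [[P0 PD] P1 PM]; split; first split.
- by rewrite /preimage /= rmorph0.
- by move=> a x y; rewrite /preimage /= rmorphD rmorphM; apply: PD.
- by rewrite /preimage /= rmorph1.
- by move=> x y; rewrite /preimage /= rmorphM; apply: PM.
Qed.

Lemma rker_prime (R S : comNzRingType) (f : {rmorphism R -> S}) :
  is_domain S -> is_prime (rker f).
Proof.
move=> domS; apply: (@preimage_prime _ _ f [set 0]); split; first split => //=.
- by move=> a x y -> ->; rewrite mulr0 addr0.
- by move=> /eqP; rewrite oner_eq0.
- by move=> x y /domS.
Qed.

Lemma gquot_prime_domain (R : comNzRingType) (P : set R)
  (h : ~ ideal_gen P 1) : is_prime P -> is_domain (gquot h).
Proof.
move=> [idP _ PM] x y.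
have [[p <-] [q <-]] := (gquot_pi_surj x, gquot_pi_surj y).
have piE z : gquot_pi h z = 0 <-> P z.
  rewrite -(rmorph0 (gquot_pi h)) gquot_piP subr0.
  by split=> [|/ideal_gen_sub//]; apply: ideal_gen_least.
by rewrite -rmorphM !piE => /PM.
Qed.

(** The extension of [I] to the polynomial ring, described by coefficients. *)
Definition poly_ext (R : comNzRingType) (I : set R) : set {poly R} :=
  [set p | forall i, I p`_i].

(** It is the kernel of reduction to polynomials over [R/P], which form a domain. *)
Lemma poly_ext_prime (R : comNzRingType) (P : set R) :
  is_prime P -> is_prime (poly_ext P).
Proof.
move=> primeP; have [idP P1 _] := primeP.
have h : ~ ideal_gen P 1 by move/(ideal_gen_least idP (@subset_refl _ P)).
have -> : poly_ext P = rker (map_poly (gquot_pi h)).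
  apply/seteqP; split=> p /=.
    move=> pP; apply/polyP => i; rewrite coef_map coef0 /=.
    by rewrite -(rmorph0 (gquot_pi h)); apply/gquot_piP; rewrite subr0;
      apply: ideal_gen_sub.
  move=> p0 i; have := congr1 (fun q : {poly _} => q`_i) p0.
  rewrite /= coef_map coef0 -(rmorph0 (gquot_pi h)) => /gquot_piP.
  by rewrite subr0; apply: ideal_gen_least.
by apply: rker_prime; apply: poly_domain; apply: gquot_prime_domain.
Qed.

Lemma poly_ext_sub (R : comNzRingType) (Q : set {poly R}) :
  is_ideal Q -> poly_ext (polyC @^-1` Q) `<=` Q.
Proof.
move=> idQ p pQ; rewrite -[p]coefK poly_def; apply: big_ind.
- by case: idQ.
- by move=> x y; apply: idealDl.
- by move=> i _; rewrite -mul_polyC mulrC; apply: idealMl => //; apply: pQ.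
Qed.

(** An ideal maximal among the proper ideals containing [I] is prime. *)
Lemma exists_prime (R : comNzRingType) (I : set R) :
  is_ideal I -> ~ I 1 -> exists2 P, is_prime P & I `<=` P.
Proof.
move=> idI I1; pose good (X : set R) := [/\ is_ideal X, ~ X 1 & I `<=` X].
(* Zorn_bigcup also requires the union of the empty chain. *)
have [M [Mgood Mmax]] : exists M, (M = set0 \/ good M) /\
    forall X, M `<` X -> ~ (X = set0 \/ good X).
  apply: (@Zorn_bigcup R [set X | X = set0 \/ good X]) => F FP Ftot.
  have [Fne|Fe] := pselect (exists2 X, F X & good X); last first.
    left; apply/seteqP; split=> // x [X FX Xx].
    have [X0|gX] := FP X FX; first by rewrite X0 in Xx.
    by case: Fe; exists X.
  right; have [X0 FX0 [[X00 _] _ IX0]] := Fne.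
  have gF X x : F X -> X x -> good X.
    by move=> FX Xx; have [X0'|//] := FP X FX; rewrite X0' in Xx.
  split; first split.
  - by exists X0.
  - move=> a x y [X FX Xx] [Y FY Yy].
    have [[[_ XP] _ _] [[_ YP] _ _]] := (gF X x FX Xx, gF Y y FY Yy).
    have [XY|YX] := Ftot X Y FX FY.
      by exists Y => //; apply: YP => //; apply: XY.
    by exists X => //; apply: XP => //; apply: YX.
  - by move=> [X FX X1]; have [_ /(_ X1)] := gF X 1 FX X1.
  - by move=> x Ix; exists X0 => //; apply: IX0.
have {Mgood} [M0|[idM M1 IM]] := Mgood.
  case: (Mmax I); last by right; split.
  by rewrite M0; split=> // I0; have [/I0] := idI.
exists M => //; split=> // x y Mxy.
apply: contrapT => /not_orP[nMx nMy].
(* The ideal [M + (x)] is strictly larger than [M]. It is also proper: [1 = m + a x] would give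
   [y = m y + a x y] in [M]. *)
pose X : set R := [set z | exists2 m, M m & exists a, z = m + a * x].
have MX : M `<=` X by move=> m Mm; exists m => //; exists 0; rewrite mul0r addr0.
have Xx : X x by exists 0; [case: idM | exists 1; rewrite mul1r add0r].
apply: (Mmax X); first by split=> // /(_ x Xx).
right; split; first split.
- by apply: MX; case: idM.
- move=> a _ _ [m Mm [b ->]] [m' Mm' [b' ->]]; exists (a * m + m').
    by case: idM => _; apply.
  by exists (a * b + b'); rewrite mulrDr mulrDl mulrA addrACA.
- move=> [m Mm [a m1]]; apply: nMy; rewrite -[y]mul1r m1 mulrDl -mulrA [m * y]mulrC.
  by apply: idealDl => //; apply: idealMl.
- exact: subset_trans MX.
Qed.

Section SpecPoint.
Variable A : comNzRingType.

Lemma Spec_prime (P : Spec A) :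
  is_prime [set x | x \in (P : prime_idealr A)].
Proof.
split; first split.
- exact: rpred0.
- by move=> a x y xP yP; apply: rpredD => //; apply: idealMr.
- by move=> /=; rewrite idealr1.
- by move=> x y /=; rewrite prime_idealrM => /orP.
Qed.

(** The primality proof is an argument so that the ideal structures below can be attached to the
    predicate. *)
Definition prime_pred (Q : set A) of is_prime Q : A -> bool :=
  fun x => `[< Q x >].

Fact prime_pred_idealr Q (h : is_prime Q) : idealr_closed (prime_pred h).
Proof.
have [[Q0 QP] Q1 _] := h; split=> [||a x y].
- exact/asboolP.
- exact/asboolP.
- by move=> /asboolP Qx /asboolP Qy; apply/asboolP; apply: QP.
Qed.
HB.instance Definition _ Q (h : is_prime Q) :=
  isIdealr.Build A (prime_pred h) (prime_pred_idealr h).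

Fact prime_pred_prime Q (h : is_prime Q) : prime_idealr_closed (prime_pred h).
Proof.
have [_ _ QM] := h.
by move=> x y /asboolP/QM[] ?; apply/orP; [left|right]; apply/asboolP.
Qed.
HB.instance Definition _ Q (h : is_prime Q) :=
  isPrimeIdealrClosed.Build A (prime_pred h) (@prime_pred_prime Q h).

Definition prime_point Q (h : is_prime Q) : Spec A := prime_pred h.

Lemma prime_pointE Q (h : is_prime Q) x :
  (x \in (prime_point h : prime_idealr A)) = `[< Q x >].
Proof. by []. Qed.

(** Closed sets are stable under specialization; this applies to [U] and to its complement. *)
Lemma clopen_specialization (U : set (Spec A)) (P P' : Spec A) :
  clopen U ->
  (forall x, x \in (P : prime_idealr A) -> x \in (P' : prime_idealr A)) ->
  U P <-> U P'.
Proof.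
have up (V : set (Spec A)) : closed V ->
    (forall x, x \in (P : prime_idealr A) -> x \in (P' : prime_idealr A)) ->
    V P -> V P'.
  move=> /closed_openC[S VS] PP'.
  have -> : V = zariski_closed S by rewrite -[V]setCK VS setCK.
  by move=> VP x Sx; apply/PP'/VP.
move=> [oU cU] PP'; split; first exact: up.
apply: contraPP; exact: (up (~` U) (open_closedC oU) PP').
Qed.

End SpecPoint.

Section GquotSpec.
Variables (T : comNzRingType) (S : set T) (h : ~ ideal_gen S 1).

(** [Q] is the contraction of [P] to [T]. Points of the quotient are studied through primes of [T]
    containing [S]. *)
Definition lies_over (P : Spec (gquot h)) (Q : set T) : Prop :=
  forall p, gquot_pi h p \in (P : prime_idealr (gquot h)) <-> Q p.

Lemma Spec_over (P : Spec (gquot h)) :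
  exists Q, [/\ is_prime Q, S `<=` Q & lies_over P Q].
Proof.
exists [set p | gquot_pi h p \in (P : prime_idealr (gquot h))]; split=> //.
  exact: (preimage_prime (gquot_pi h) (Spec_prime P)).
move=> s /ideal_gen_sub Ss /=.
have -> : gquot_pi h s = 0.
  by rewrite -(rmorph0 (gquot_pi h)); apply/gquot_piP; rewrite subr0.
exact: rpred0.
Qed.

Lemma over_Spec Q : is_prime Q -> S `<=` Q -> exists P, lies_over P Q.
Proof.
move=> primeQ SQ; have [[Q0 QD] Q1 QM] := primeQ.
pose Q' : set (gquot h) := gquot_pi h @` Q.
(* As [Q] contains [S], membership in [Q] depends only on the class modulo [S]. *)
have Q'E p : Q' (gquot_pi h p) <-> Q p.
  split=> [[q Qq /gquot_piP/(ideal_gen_least (conj Q0 QD) SQ) qp]|Qp].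
    by rewrite -[p](subKr q) -mulN1r addrC; apply: QD.
  by exists p.
have surj := @gquot_pi_surj _ _ h.
have Q'prime : is_prime Q'.
  split; first split.
  - by rewrite -(rmorph0 (gquot_pi h)) Q'E.
  - move=> a x y; have [[a' <-] [x' <-] [y' <-]] := And3 (surj a) (surj x) (surj y).
    by rewrite -rmorphM -rmorphD !Q'E; apply: QD.
  - by rewrite -(rmorph1 (gquot_pi h)) Q'E.
  - move=> x y; have [[x' <-] [y' <-]] := (surj x, surj y).
    by rewrite -rmorphM !Q'E; apply: QM.
exists (prime_point Q'prime) => p; rewrite prime_pointE -Q'E.
by split=> /asboolP.
Qed.

Lemma clopen_over (U : set (Spec (gquot h))) (P P' : Spec (gquot h)) Q Q' :
  clopen U -> lies_over P Q -> lies_over P' Q' -> Q `<=` Q' -> U P <-> U P'.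
Proof.
move=> clU PQ PQ' QQ'; apply: clopen_specialization => // x.
by have [p <-] := gquot_pi_surj x; rewrite PQ PQ'; apply: QQ'.
Qed.

End GquotSpec.

(** * Connectedness *)

(** Comparing coefficients forces [y] to be minus the geometric series in [c X], which is a
    polynomial only if [c] is nilpotent. *)
Lemma geometric_inverse (B : comNzRingType) (c : B) (y : {poly B}) :
  1 = y * (c%:P * 'X - 1) -> exists N, c ^+ N = 0.
Proof.
move=> yE; have coefE i : y`_i = - c ^+ i.
  have E k : (k == 0%N)%:R = (if k == 0%N then 0 else (y * c%:P)`_k.-1) - y`_k.
    by rewrite -coef1 {1}yE mulrBr mulr1 mulrA coefB coefMX.
  elim: i => [|i IHi]; have := E _.
    by move=> /(_ 0%N) /=; rewrite sub0r => e; apply: oppr_inj; rewrite -e opprK.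
  move=> /(_ i.+1)/esym/eqP; rewrite /= coefMC IHi subr_eq0 => /eqP <-.
  by rewrite mulNr -exprSr.
by exists (size y); apply/eqP; rewrite -oppr_eq0 -coefE nth_default.
Qed.

Section DeformConnected.
Variables (R : comNzRingType) (F : fgl R).
Hypotheses (domR : is_domain R) (two_neq0 : 2%:R <> 0 :> R)
  (two_nonunit : forall x : R, 2%:R * x <> 1).

Let f := two_series F.
Let u := fps_u R.
Let uX1 : {poly {fps R[1]}} := u%:P * 'X - 1.

Let deform_relE : deform_rel F = - (f%:P * uX1).
Proof. by rewrite -mulrN opprB. Qed.

Let rel_sub (Q : set {poly {fps R[1]}}) : is_ideal Q ->
  Q f%:P \/ Q uX1 -> [set deform_rel F] `<=` Q.
Proof.
move=> idQ QfX _ ->; rewrite deform_relE -mulN1r; apply: idealMl => //.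
by case: QfX => [Qf|QX]; [rewrite mulrC|]; apply: idealMl.
Qed.

Let point (Q : set {poly {fps R[1]}}) : is_prime Q -> Q f%:P \/ Q uX1 ->
  exists P, lies_over (h := @deform_proper R F) P Q.
Proof.
by move=> primeQ QfX; apply: over_Spec => //; apply: rel_sub => //; case: primeQ.
Qed.

(** If V(f) and V(u w - 1) were disjoint, [u w - 1] would be a unit in polynomials over
    [R[[u]]/(f)]. Then [u] would be nilpotent there, so [f] would divide a power of [u]. *)
Let meet_proper : ~ ideal_gen [set f%:P; uX1] 1.
Proof.
pose phi : {rmorphism {poly {fps R[1]}} -> {poly borel_ring F}} :=
  map_poly (to_borel F).
have phiX : phi uX1 = (to_borel F u)%:P * 'X - 1.
  by rewrite rmorphB rmorphM rmorph1 /= map_polyC map_polyX.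
pose I : set {poly {fps R[1]}} :=
  [set p | exists y, phi p = y * ((to_borel F u)%:P * 'X - 1)].
have idI : is_ideal I.
  split; first by exists 0; rewrite mul0r rmorph0.
  move=> a x y [x' xE] [y' yE]; exists (phi a * x' + y').
  by rewrite rmorphD rmorphM xE yE mulrDl mulrA.
move=> /(ideal_gen_least idI)[].
  move=> _ [->|->]; last by exists 1; rewrite mul1r phiX.
  exists 0; rewrite mul0r /= map_polyC /=.
  have -> : to_borel F f = 0; last by rewrite polyC0.
  by rewrite -(rmorph0 (to_borel F)); apply/gquot_piP; rewrite subr0;
    apply: ideal_gen_sub.
move=> y; rewrite rmorph1 => /geometric_inverse[N].
rewrite -rmorphXn -(rmorph0 (to_borel F)) => /gquot_piP.
rewrite subr0 => /ideal_gen1P[g]; exact: two_series_no_power.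
Qed.

Lemma deform_Spec_connected :
  [set: Spec (deform_ring F)] !=set0 /\ connected [set: Spec (deform_ring F)].
Proof.
have u0 : u <> 0.
  move/(congr1 (fun g : {fps R[1]} => g U_(ord0)%MM)); rewrite /= eqxx => /eqP.
  by rewrite oner_eq0.
have domS := @fps_domain 1 R domR.
(* The generic point of V(u w - 1): the kernel of the map to [R[[u]][1/u]], a domain. *)
pose eta := rker (gquot_pi (invert_proper domS u0)).
have eta_prime : is_prime eta by apply: rker_prime; apply: invert_domain.
have eta_uX1 : eta uX1.
  rewrite /eta /rker /= -(rmorph0 (gquot_pi _)); apply/gquot_piP.
  by rewrite subr0; apply: ideal_gen_sub.
have eta_sub (Q : set {poly {fps R[1]}}) : is_ideal Q -> Q uX1 -> eta `<=` Q.
  move=> idQ QX p; rewrite /eta /rker /= -(rmorph0 (gquot_pi _)) => /gquot_piP.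
  by rewrite subr0; apply: ideal_gen_least => // _ ->.
(* The generic point of V(u): setting [u = 0] leaves the domain [R[w]]. *)
pose zeta := rker (map_poly (@fps_const 1 R)).
have zeta_prime : is_prime zeta by apply: rker_prime; apply: poly_domain.
have zeta_f : zeta f%:P.
  have f0 : fps_const f = 0 := two_series_const0 F.
  by rewrite /zeta /rker /= map_polyC; apply: etrans (congr1 polyC f0) (polyC0 _).
have [Peta Peta_over] := point eta_prime (or_intror eta_uX1).
have [Pzeta Pzeta_over] := point zeta_prime (or_introl zeta_f).
split; first by exists Pzeta.
have clopen_zeta U (P : Spec (deform_ring F)) : clopen U -> U P <-> U Pzeta.
  move=> clU.
  (* With [p] the contraction of [Q] and [m] a prime containing [p] and [u], the inclusions Q ⊇ p[w]
     ⊆ m[w] ⊇ [zeta] join [P'] to [Pzeta] by specializations, which [U] cannot separate. *)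
  have via_f (P' : Spec (deform_ring F)) Q : is_prime Q -> lies_over P' Q ->
      Q f%:P -> U P' <-> U Pzeta.
    move=> primeQ P'Q Qf; have [idQ _ _] := primeQ.
    pose p := polyC @^-1` Q.
    have pprime : is_prime p := preimage_prime polyC primeQ.
    have [idp p1 _] := pprime.
    (* u lies in the Jacobson radical of R[[u]], so p + (u) is proper. *)
    pose J : set {fps R[1]} := [set x | exists2 a, p a & fps_const x = fps_const a].
    have [m mprime Jm] : exists2 m, is_prime m & J `<=` m.
      apply: exists_prime; first split.
      - by exists 0 => //; case: idp.
      - move=> c x y [a pa xa] [b pb yb]; exists (c * a + b).
          by case: idp => _; apply.
        by rewrite !rmorphD !rmorphM /= xa yb.
      - move=> [a pa]; rewrite [LHS]rmorph1 => /esym/fps_inv[g ag].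
        by apply: p1; rewrite -ag mulrC; apply: idealMl.
    have pm : p `<=` m by move=> a pa; apply: Jm; exists a.
    have ext_f (I : set {fps R[1]}) : I 0 -> I f -> poly_ext I f%:P.
      by move=> I0 If i; rewrite coefC; case: ifP.
    have [Pp Pp_over] := point (poly_ext_prime pprime)
      (or_introl (ext_f _ (proj1 idp) Qf)).
    have [m0 _] : is_ideal m by case: mprime.
    have [Pm Pm_over] := point (poly_ext_prime mprime)
      (or_introl (ext_f _ m0 (pm _ Qf))).
    rewrite -(clopen_over clU Pp_over P'Q (poly_ext_sub idQ)).
    rewrite (clopen_over clU Pp_over Pm_over (fun q pq i => pm _ (pq i))).
    symmetry; apply: clopen_over clU Pzeta_over Pm_over _ => q q0 i.
    apply: Jm; exists 0; first by case: idp.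
    have := congr1 (fun q : {poly R} => q`_i) q0.
    by rewrite coef_map coef0.
  (* A prime in both pieces: it specializes [eta] and, by [via_f], is joined to [zeta]. *)
  have [Q0 Q0prime Q0sub] := exists_prime (ideal_gen_ideal _) meet_proper.
  have Q0f : Q0 f%:P by apply/Q0sub/ideal_gen_sub; left.
  have Q0X : Q0 uX1 by apply/Q0sub/ideal_gen_sub; right.
  have idQ0 : is_ideal Q0 by case: Q0prime.
  have [P0 P0_over] := point Q0prime (or_introl Q0f).
  have eta_zeta : U Peta <-> U Pzeta.
    by rewrite -(via_f P0 Q0) //; apply: clopen_over clU _ P0_over (eta_sub _ _ _).
  have [Q [Qprime Qrel PQ]] := Spec_over P; have [idQ _ QM] := Qprime.
  have : Q (f%:P * uX1).
    by rewrite -[_ * _]opprK -deform_relE -mulN1r; apply: idealMl => //; apply: Qrel.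
  move=> /QM[Qf|QX]; first exact: via_f PQ Qf.
  rewrite -eta_zeta; symmetry.
  by apply: clopen_over clU Peta_over PQ (eta_sub _ _ _).
move=> U [P UP] [C oC UC] [D cD UD].
have clU : clopen U by split; [rewrite UC setTI | rewrite UD setTI].
by apply/seteqP; split=> // P' _; rewrite (clopen_zeta U) // -(clopen_zeta U P).
Qed.

End DeformConnected.

(** * Equivariant formal group laws *)

Section ConstantSeries.
Variable R : comNzRingType.

Lemma fps1C_coefM (c : R) g m : (fps1C c * g) m = c * g m.
Proof.
have -> : m = (0 + m)%MM by rewrite add0m.
rewrite fps_coefM_single /= ?eqxx ?mulr1n ?add0m // => a b _ /negPf ->.
by rewrite mulr0n mul0r.
Qed.

Fact fps1C_zmod : zmod_morphism (@fps1C R).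
Proof. by move=> c d; apply: fpsP => m /=; rewrite mulrnBl. Qed.
HB.instance Definition _ :=
  GRing.isZmodMorphism.Build R {fps R[1]} (@fps1C R) fps1C_zmod.
Fact fps1C_monoid : monoid_morphism (@fps1C R).
Proof.
split=> [|c d]; apply: fpsP => m; first by [].
by rewrite fps1C_coefM /= mulrnAr.
Qed.
HB.instance Definition _ :=
  GRing.isMonoidMorphism.Build R {fps R[1]} (@fps1C R) fps1C_monoid.

(** Splitting off the constant term is the source of the recursions [q_j = c_j + u q_(j+1)] and
    [b_ij = a_ij + u b_(i,j+1)]. *)
Lemma fps1_shift (c : nat -> R) :
  fps1 c = fps1C (c 0%N) + fps_u R * fps1 (fun k => c k.+1).
Proof.
rewrite -[LHS](subrK (fps1C (c 0%N))) addrC; congr (_ + _).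
rewrite [LHS]fps1_factor.
  congr (_ * _); apply: fpsP => m /=.
  by rewrite mdegD mdeg1 add1n -mdeg_eq0 mdegD mdeg1 subr0.
by rewrite fps_constE fps_coefB /= mdeg0 eqxx subrr.
Qed.

Lemma two_series_fps1 (F : {fps R[2]}) : two_series F = fps1 (two_coef F).
Proof. by apply: fpsP => m; rewrite [in LHS](mnm_ord1 m). Qed.

Lemma q_series0 (F : fgl R) : q_series F 0 = two_series F.
Proof.
by rewrite two_series_fps1; apply: fpsP => m /=; rewrite addn0.
Qed.

Lemma q_series_shift (F : fgl R) j :
  q_series F j = fps1C (two_coef F j) + fps_u R * q_series F j.+1.
Proof.
rewrite [LHS]fps1_shift; congr (_ + _ * _).
by apply: fpsP => m /=; rewrite addnS.
Qed.

Lemma b_series_shift (F : fgl R) i j :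
  b_series F i j = fps1C (fgl_coef F i j) + fps_u R * b_series F i j.+1.
Proof.
rewrite [LHS]fps1_shift; congr (_ + _ * _).
by apply: fpsP => m /=; rewrite addnS.
Qed.

End ConstantSeries.

(** * Homomorphisms out of polynomial rings and out of [MUZ2] *)

(** Induction on total degree, dividing a nontrivial monomial by a variable occurring in it. *)
Lemma cmonom_ind (I : choiceType) (P : cmonom I -> Prop) :
  P mone -> (forall i m, P m -> P (mmul (ucm i) m)) -> forall m, P m.
Proof.
move=> P1 PU m; have [d] := ubnP (monalg.mdeg m).
elim: d m => // d IHd m; rewrite ltnS => md.
have [->//|m1] := eqVneq m mone.
have [i mi] : exists i, m i != 0%N.
  apply: contrapT => m0; case/negP: m1; apply/cmP => i; rewrite cm1.
  by apply/eqP/contraT => mi; case: m0; exists i.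
have mE : m = mmul (ucm i) (divcm m (ucm i)).
  apply/eqP/cmP => j; rewrite cmM divcmE cmU subnKC //.
  by case: eqVneq => // <-; rewrite lt0n.
rewrite mE; apply/PU/IHd; move: md.
by rewrite {1}mE mdegM mdegU.
Qed.

Lemma polyring_rmorph_ext (I : choiceType) (R T : comNzRingType)
    (f g : {rmorphism polyring I R -> T}) :
  (forall i, f (pvar R i) = g (pvar R i)) ->
  (forall c, f (pconst I c) = g (pconst I c)) -> f =1 g.
Proof.
move=> fgX fgC p.
(* Hiding the monomials behind U keeps unification from unfolding polyring. *)
have [U [U1 UM UE]] : exists U : cmonom I -> polyring I R,
    [/\ U mone = pconst I 1, forall i m, U (mmul (ucm i) m) = pvar R i * U m
      & p = \sum_(k <- monalg.msupp p) pconst I (monalg.mcoeff k p) * U k].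
  exists (fun m => mkmalgU m 1); split=> //.
    move=> i m; apply: esym; apply: etrans (fgmulUU _ _ _ _) _.
    by rewrite mulr1.
  apply: etrans (monalgE p) _; apply: eq_bigr => k _; apply: esym.
  by apply: etrans (fgmulUU _ _ _ _) _; rewrite mulr1 mul1m.
have fgU m : f (U m) = g (U m).
  by elim/cmonom_ind: m => [|i m IHm]; rewrite ?U1 // UM !rmorphM fgX IHm.
by rewrite UE !rmorph_sum; apply: eq_bigr => k _; rewrite !rmorphM fgC fgU.
Qed.

Section MUZ2Universal.
Variables (A : comNzRingType).

Lemma MUZ2_ext (phi psi : {rmorphism MUZ2 -> A}) :
  (forall x, phi (MUZ2_of_lazard x) = psi (MUZ2_of_lazard x)) ->
  phi MUZ2_u = psi MUZ2_u -> (forall j, phi (MUZ2_q j) = psi (MUZ2_q j)) ->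
  (forall i j, phi (MUZ2_b i j) = psi (MUZ2_b i j)) -> phi =1 psi.
Proof.
move=> eC eu eq eb x; have [p <-] := gquot_pi_surj x.
pose pi : {rmorphism z2pre -> MUZ2} := gquot_pi z2_proper.
apply: (@polyring_rmorph_ext _ _ _ (phi \o pi) (psi \o pi)) => [[|j|i j]|c].
- exact: eu.
- exact: eq.
- exact: eb.
- exact: eC.
Qed.

(** The three equations say that the prescribed values respect the three families of relations in
    [z2_rel]. *)
Lemma MUZ2_rect (e : {rmorphism lazard -> A}) (u : A) (q : nat -> A)
    (b : nat -> nat -> A) :
  q 0%N = 0 ->
  (forall j, q j = e (two_coef lazard_fgl j) + u * q j.+1) ->
  (forall i j, b i j = e (fgl_coef lazard_fgl i.+1 j) + u * b i j.+1) ->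
  exists phi : {rmorphism MUZ2 -> A},
    [/\ forall x, phi (MUZ2_of_lazard x) = e x, phi MUZ2_u = u,
        forall j, phi (MUZ2_q j) = q j & forall i j, phi (MUZ2_b i j) = b i j].
Proof.
move=> q0 qS bS.
pose v g := match g with GenU => u | GenQ j => q j | GenB i j => b i j end.
have [ev evV evC] : exists2 ev : {rmorphism z2pre -> A},
    forall g, ev (pvar lazard g) = v g & forall c, ev (pconst z2gen c) = e c.
  by exists (peval e v) => x; [apply: peval_var | apply: peval_const].
have ev_rel r : z2_rel r -> ev r = 0.
  have evR x y z t : ev x = ev y + ev z * ev t -> ev (x - y - z * t) = 0.
    by move=> xE; rewrite !rmorphB rmorphM xE [ev y + _]addrC addrK subrr.
  case=> [|j|i j]; first by transitivity (q 0%N); [exact: evV | exact: q0].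
    apply: evR; transitivity (q j); [exact: evV | rewrite qS].
    by congr (_ + _ * _); apply: esym; [exact: evC | exact: evV | exact: evV].
  apply: evR; transitivity (b i j); [exact: evV | rewrite bS].
  by congr (_ + _ * _); apply: esym; [exact: evC | exact: evV | exact: evV].
exists (gquot_lift (h := z2_proper) ev_rel); split=> [x||j|i j].
- by rewrite -evC; apply: gquot_lift_pi.
- by transitivity (ev (pvar lazard GenU)); [exact: gquot_lift_pi | exact: evV].
- by transitivity (ev (pvar lazard (GenQ j))); [exact: gquot_lift_pi | exact: evV].
- by transitivity (ev (pvar lazard (GenB i j))); [exact: gquot_lift_pi | exact: evV].
Qed.

End MUZ2Universal.

Section EquivariantLaws.
Variables (R : comNzRingType) (F : fgl R).

Lemma classify_two_coef j :
  lazard_classify F (two_coef lazard_fgl j) = two_coef F j.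
Proof. by rewrite /two_coef -(lazard_classifyE F) -fps_map_two_series. Qed.

Lemma classify_fgl_coef i j :
  lazard_classify F (fgl_coef lazard_fgl i j) = fgl_coef F i j.
Proof. by rewrite -[in RHS](lazard_classifyE F). Qed.

Lemma classified_by_uniq (A : comNzRingType) (e : R -> A) u b q
    (phi psi : Z2fgl A) :
  classified_by F e u b q phi -> classified_by F e u b q psi -> psi =1 phi.
Proof.
move=> [eC eu eb eq] [eC' eu' eb' eq'].
by apply: MUZ2_ext => *; rewrite ?(eC, eu, eb, eq) ?(eC', eu', eb', eq').
Qed.

Lemma to_borel_two_series : to_borel F (two_series F) = 0.
Proof.
rewrite -(rmorph0 (to_borel F)); apply/gquot_piP; rewrite subr0.
exact: ideal_gen_sub.
Qed.

Lemma to_deform_rel : to_deform F (deform_rel F) = 0.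
Proof.
rewrite -(rmorph0 (to_deform F)); apply/gquot_piP; rewrite subr0.
exact: ideal_gen_sub.
Qed.

Lemma borel_law_exists : exists phi, is_borel_law (F := F) phi.
Proof.
pose C : {rmorphism R -> {fps R[1]}} := @fps1C R.
pose e : {rmorphism lazard -> borel_ring F} := to_borel F \o C \o lazard_classify F.
have eE x : e x = to_borel F (fps1C (lazard_classify F x)) by [].
have [||| phi [eC eu eq eb]] := @MUZ2_rect _ e (to_borel F (fps_u R))
  (fun j => to_borel F (q_series F j)) (fun i j => to_borel F (b_series F i.+1 j)).
- by rewrite q_series0 to_borel_two_series.
- by move=> j; rewrite eE classify_two_coef -rmorphM -rmorphD -q_series_shift.
- by move=> i j; rewrite eE classify_fgl_coef -rmorphM -rmorphD -b_series_shift.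
by exists phi; split.
Qed.

Lemma deformed_law_exists : exists phi, is_deformed_law (F := F) phi.
Proof.
pose C : {rmorphism R -> {poly {fps R[1]}}} := polyC \o @fps1C R.
pose e : {rmorphism lazard -> deform_ring F} := to_deform F \o C \o lazard_classify F.
have eE x : e x = to_deform F ((fps1C (lazard_classify F x))%:P) by [].
have [||| phi [eC eu eq eb]] := @MUZ2_rect _ e (to_deform F (fps_u R)%:P)
  (fun j => to_deform F ((q_series F j)%:P - 'X^j * (two_series F)%:P))
  (fun i j => to_deform F (b_series F i.+1 j)%:P).
- by rewrite q_series0 expr0 mul1r subrr rmorph0.
- move=> j; rewrite eE classify_two_coef -rmorphM -rmorphD.
  apply/eqP; rewrite -subr_eq0 -rmorphB; apply/eqP.
  (* The recursion for [q_series] leaves only the corrections: -w^j [2]u + u w^(j+1) [2]u = -w^j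
     [2]u (1 - u w). *)
  suff -> : (q_series F j)%:P - 'X^j * (two_series F)%:P
      - ((fps1C (two_coef F j))%:P + (fps_u R)%:P *
         ((q_series F j.+1)%:P - 'X^(j.+1) * (two_series F)%:P))
      = - 'X^j * deform_rel F by rewrite rmorphM to_deform_rel mulr0.
  rewrite /deform_rel q_series_shift polyCD polyCM exprSr mulrBr addrA.
  rewrite opprB [LHS]addrC addrA subrK mulNr mulrBr mulr1 mulrBr opprB.
  congr (_ - _); rewrite -!mulrA mulrCA; congr (_ * _).
  by rewrite mulrA [RHS]mulrC.
- by move=> i j; rewrite eE classify_fgl_coef -rmorphM -rmorphD -polyCM -polyCD
    -b_series_shift.
by exists phi; split.
Qed.

Lemma deform_w0_to_deform p :
  deform_w0 F (to_deform F p) = to_borel F p.[0].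
Proof. exact: gquot_lift_pi. Qed.

Lemma deformed_law_w0 (borel : Z2fgl (borel_ring F)) phi :
  is_borel_law borel -> is_deformed_law phi ->
  forall x, deform_w0 F (phi x) = borel x.
Proof.
move=> [eC eu eb eq] [eC' eu' eb' eq'].
apply: (@MUZ2_ext _ (deform_w0 F \o phi)) => [x||j|i j] /=.
- by rewrite eC' eC [LHS]deform_w0_to_deform hornerC.
- by rewrite eu' eu [LHS]deform_w0_to_deform hornerC.
(* At [w = 0] the correction is [[2]u] for [j = 0], not zero as a series; it dies because it is a
   multiple of [[2]u]. *)
- rewrite eq' eq [LHS]deform_w0_to_deform hornerD hornerN hornerM !hornerC hornerXn.
  by rewrite rmorphB rmorphM to_borel_two_series mulr0 subr0.
- by rewrite eb' eb [LHS]deform_w0_to_deform hornerC.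
Qed.

End EquivariantLaws.

(** * The Lubin-Tate coefficient ring *)

Lemma laurent_eval1 (R : comNzRingType) : inhabited {rmorphism laurent R -> R}.
Proof.
have t1 (x : {poly {poly R}}) : laurent_rel x ->
    (@horner_eval R 1 \o @horner_eval {poly R} 1) x = 0.
  by move=> ->; rewrite /= /horner_eval !hornerE subrr.
by constructor; exact: (gquot_lift (h := @laurent_proper R) t1).
Qed.

Theorem mainTheorem7 (kappa : fieldType) (kappa_char2 : 2%N \in [pchar kappa])
    (kappa_perfect : forall x : kappa, exists y : kappa, y ^+ 2 = x)
    (W : comNzRingType) (res : {rmorphism W -> kappa})
    (W_witt : is_witt_ring 2 res)
    (n : nat) (n_gt0 : (0 < n)%N)
    (G : fgl kappa) (G_height : has_height_at2 G n)
    (F0 : fgl (LT_ring0 W n))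
    (F0_univ : universal_deformation G (LT_res n res) F0) :
  let F := LT_fgl F0 in
  (exists (borel : Z2fgl (borel_ring F)) (phi : Z2fgl (deform_ring F)),
     [/\ is_borel_law borel
           /\ (forall borel', is_borel_law borel' -> borel' =1 borel),
         is_deformed_law phi
           /\ (forall phi', is_deformed_law phi' -> phi' =1 phi)
       & forall x : MUZ2, deform_w0 F (phi x) = borel x]) /\
  ([set: Spec (deform_ring F)] !=set0 /\
   connected [set: Spec (deform_ring F)]).
Proof.
move=> F; split.
  have [borel borelP] := borel_law_exists F.
  have [phi phiP] := deformed_law_exists F.
  exists borel, phi; split; [split=> // | split=> // |].
  - by move=> psi; apply: classified_by_uniq.
  - by move=> psi; apply: classified_by_uniq.
  - exact: deformed_law_w0.
have two_kappa : 2%:R = 0 :> kappa by apply: pcharf0.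
have domE : is_domain (LT_ring W n).
  by apply: laurent_domain; apply: fps_domain; apply: witt_domain W_witt.
have [ev1] := laurent_eval1 (LT_ring0 W n).
(* Setting [t = 1] and every [u_i = 0] sends 2 to 2 in [W], which is nonzero because 2 is regular
   there. Reducing further to [kappa], 2 becomes zero and so cannot be a unit. *)
pose toW : {rmorphism LT_ring W n -> W} := @fps_const n.-1 W \o ev1.
apply: deform_Spec_connected => //.
- move=> /(congr1 toW); rewrite rmorph_nat rmorph0.
  have [_ _ two_reg _] := W_witt.
  by move=> two0; have /eqP := two_reg 1 (etrans (mulr1 _) two0); rewrite oner_eq0.
- move=> x /(congr1 (res \o toW)); rewrite rmorphM rmorph_nat two_kappa mul0r.
  by rewrite rmorph1 => /eqP; rewrite eq_sym oner_eq0.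
Qed.
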